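(* Let $M$ be a finitely generated left cancellative monoid of bounded indegree which is strongly hyperbolic. Then the $\mathcal{L}$-order and the $\mathcal{R}$-order for $M$ are both in $\mathcal{NP}$.
   Context: Directed graphs may have loops and multiple edges; $d(u,v)$ is the length of a shortest directed path from $u$ to $v$ ($\infty$ if none). Out-ball $\overrightarrow{\mathcal{B}}_r(x)=\{y : d(x,y)\le r\}$, in-ball $\overleftarrow{\mathcal{B}}_r(x)=\{y : d(y,x)\le r\}$, extended to sets by union. A path $[x_0,\dots,x_n]$ is a geodesic if $n=d(x_0,x_n)$. A directed geodesic triangle is an ordered triple $(p,q,r)$ of geodesics with the end of $p$ equal to the start of $q$ and $p\circ q$ having the same start and end as $r$; it is $\delta$-thin if every vertex of $r$ lies in $\overrightarrow{\mathcal{B}}_\delta(p)\cup\overleftarrow{\mathcal{B}}_\delta(q)$, every vertex of $p$ lies in $\overrightarrow{\mathcal{B}}_\delta(r)\cup\overleftarrow{\mathcal{B}}_\delta(q)$, and every vertex of $q$ lies in $\overrightarrow{\mathcal{B}}_\delta(p)\cup\overleftarrow{\mathcal{B}}_\delta(r)$. A directed graph is strongly $\delta$-hyperbolic if all its directed geodesic triangles are $\delta$-thin. For a monoid $M$ generated by a finite set $A$, the right Cayley graph has vertex set $M$ and an edge $m\to n$ for each $a\in A$ with $ma=n$. $M$ is strongly hyperbolic if its right Cayley graph with respect to some finite generating set is strongly $\delta$-hyperbolic for some $\delta\ge0$. $M$ has bounded indegree if for a finite generating set $A$ there is $\alpha$ such that no $a\in A$ and $\alpha+1$ distinct $x_0,\dots,x_\alpha\in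 M$ satisfy $x_0a=\dots=x_\alpha a$. Green's orders: $x\le_{\mathcal{R}} y$ iff $xM\subseteq yM$; $x\le_{\mathcal{L}} y$ iff $Mx\subseteq My$. A relation being ''in $\mathcal{NP}$'' means: deciding, given two words over a finite generating set, whether the elements they represent are related, is in $\mathcal{NP}$. *)

(* Defs.v *)
From mathcomp Require Import all_boot.
Set Implicit Arguments. Unset Strict Implicit. Unset Printing Implicit Defensive.

Definition is_monoid (M : Type) (mul : M -> M -> M) (one : M) : Prop :=
  (forall x y z, mul x (mul y z) = mul (mul x y) z) /\
  (forall x, mul one x = x) /\ (forall x, mul x one = x).

Definition left_cancellative (M : Type) (mul : M -> M -> M) : Prop :=
  forall a b c, mul a b = mul a c -> b = c.

Definition evalw (M : Type) (mul : M -> M -> M) (one : M) (A : Type)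
  (gen : A -> M) (w : seq A) : M :=
  foldl (fun m a => mul m (gen a)) one w.

Definition generates (M : Type) (mul : M -> M -> M) (one : M) (A : Type)
  (gen : A -> M) : Prop :=
  forall m, exists w : seq A, evalw mul one gen w = m.

(* Right Cayley graph w.r.t. (A, gen): edge m -> m * gen a.            *)
(* A directed path starting at x is given by x and its label word w;   *)
(* its vertices are x * eval (take i w), i = 0 .. size w.              *)
Section Cayley.
Variables (M : Type) (mul : M -> M -> M) (one : M) (A : Type) (gen : A -> M).

Local Notation ev := (evalw mul one gen).

Definition dist_le (x y : M) (n : nat) : Prop :=
  exists w : seq A, size w <= n /\ mul x (ev w) = y.

Definition path_end (x : M) (w : seq A) : M := mul x (ev w).

Definition on_path (x : M) (w : seq A) (y : M) : Prop :=
  exists i, i <= size w /\ y = mul x (ev (take i w)).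

Definition geodesic (x : M) (w : seq A) : Prop :=
  forall w' : seq A, mul x (ev w') = path_end x w -> size w <= size w'.

Definition in_out_ball (r : nat) (x : M) (w : seq A) (y : M) : Prop :=
  exists z, on_path x w z /\ dist_le z y r.
Definition in_in_ball (r : nat) (x : M) (w : seq A) (y : M) : Prop :=
  exists z, on_path x w z /\ dist_le y z r.

Definition geodesic_triangle (x : M) (u v w : seq A) : Prop :=
  geodesic x u /\ geodesic (path_end x u) v /\ geodesic x w /\
  path_end x w = path_end (path_end x u) v.

Definition triangle_thin (delta : nat) (x : M) (u v w : seq A) : Prop :=
  let y := path_end x u in
  (forall t, on_path x w t ->
     in_out_ball delta x u t \/ in_in_ball delta y v t) /\
  (forall t, on_path x u t ->
     in_out_ball delta x w t \/ in_in_ball delta y v t) /\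
  (forall t, on_path y v t ->
     in_out_ball delta x u t \/ in_in_ball delta x w t).

Definition strongly_delta_hyperbolic (delta : nat) : Prop :=
  forall x u v w, geodesic_triangle x u v w -> triangle_thin delta x u v w.

Definition bounded_indegree_wrt : Prop :=
  exists alpha : nat, forall (a : A) (xs : 'I_alpha.+1 -> M),
    (forall i j, mul (xs i) (gen a) = mul (xs j) (gen a)) ->
    exists i j, i != j /\ xs i = xs j.

End Cayley.

Definition strongly_hyperbolic (M : Type) (mul : M -> M -> M) (one : M) : Prop :=
  exists (B : finType) (genB : B -> M) (delta : nat),
    generates mul one genB /\ strongly_delta_hyperbolic mul one genB delta.

Definition bounded_indegree (M : Type) (mul : M -> M -> M) (one : M) : Prop :=
  exists (B : finType) (genB : B -> M),
    generates mul one genB /\ bounded_indegree_wrt mul genB.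

Definition R_le (M : Type) (mul : M -> M -> M) (x y : M) : Prop :=
  forall z, (exists m, z = mul x m) -> exists m, z = mul y m.
Definition L_le (M : Type) (mul : M -> M -> M) (x y : M) : Prop :=
  forall z, (exists m, z = mul m x) -> exists m, z = mul m y.

Inductive move := MoveL | MoveR | Stay.

Record TM (Sigma : Type) := {
  tm_state : finType;
  tm_gamma : finType;
  tm_blank : tm_gamma;
  tm_inj   : Sigma -> tm_gamma;
  tm_start : tm_state;
  tm_accept : tm_state;
  tm_reject : tm_state;
  tm_delta : tm_state -> tm_gamma -> tm_state * tm_gamma * move }.

Section TMrun.
Variables (Sigma : Type) (T : TM Sigma).

(* configuration: state, cells left of head (nearest first), head, cells right *)
Definition config := (tm_state T * seq (tm_gamma T) * tm_gamma T * seq (tm_gamma T))%type.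

Definition init_config (x : seq Sigma) : config :=
  match map (tm_inj T) x with
  | [::] => (tm_start T, [::], tm_blank T, [::])
  | g :: r => (tm_start T, [::], g, r)
  end.

Definition tm_step (c : config) : config :=
  let: (q, l, h, r) := c in
  if (q == tm_accept T) || (q == tm_reject T) then c else
  let: (q', g, m) := tm_delta q h in
  match m with
  | Stay => (q', l, g, r)
  | MoveL => match l with
             | [::] => (q', [::], tm_blank T, g :: r)
             | h' :: l' => (q', l', h', g :: r)
             end
  | MoveR => match r with
             | [::] => (q', g :: l, tm_blank T, [::])
             | h' :: r' => (q', g :: l, h', r')
             end
  end.

Definition accepts_within (x : seq Sigma) (t : nat) : Prop :=
  (iter t tm_step (init_config x)).1.1.1 = tm_accept T.

End TMrun.

Definition in_NP (Sigma : finType) (L : seq Sigma -> Prop) : Prop :=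
  exists (k : nat) (V : TM (Sigma + bool)%type),
    forall x : seq Sigma,
      L x <-> exists c : seq bool,
        size c <= (size x).+2 ^ k /\
        accepts_within V (map inl x ++ map inr c) ((size x).+2 ^ k).

Definition rel_in_NP (M : Type) (mul : M -> M -> M) (one : M) (A : finType)
  (gen : A -> M) (Rel : M -> M -> Prop) : Prop :=
  in_NP (fun s : seq (option A) =>
    exists u v : seq A, s = map Some u ++ None :: map Some v /\
      Rel (evalw mul one gen u) (evalw mul one gen v)).

(* Main.v *)
From HB Require Import structures.
Require Import Defs.
From mathcomp Require Import all_boot.
From mathcomp Require Import zify.
From Stdlib Require Import Classical ClassicalEpsilon.
Set Implicit Arguments. Unset Strict Implicit. Unset Printing Implicit Defensive.

(** Let [p] and [r] be geodesics from [1] to [y] and to [y * e], where [e] is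
    short.  Thinness of the triangle, bounded indegree and left cancellativity
    give constants [D] and [K] with [d(r_(i-D), p_i) <= K] for all [i].  Hence a
    letter can be absorbed into a geodesic by carrying one symbol of a ball of
    bounded radius along it, once to the right and once back: the local moves
    [k * h = h' * k'] along the way are relations of length two.  A word of
    length [n] is thus rewritten into a canonical geodesic in O(n^2) such moves,
    which is a polynomial certificate for the word problem.

    If [x = y * m] or [x = m * y], all vertices of a geodesic for [m] lie in
    out-balls or in-balls of radius [delta] around geodesics for [x] and [y].
    These balls have bounded size, so [m] has linear length and can be guessed.

    The verifier keeps both words on two tracks of one row of cells, executes the
    local moves listed in the certificate, and finally compares the tracks. *)

(** * Finite covers *)

Lemma finite_bound (T : finType) (P : T -> nat -> Prop) :
  (forall t m n, m <= n -> P t m -> P t n) ->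
  (forall t, exists n, P t n) -> exists n, forall t, P t n.
Proof.
move=> Pmono /fin_all_exists [f Pf]; exists (\max_t f t) => t.
exact: Pmono (leq_bigmax t) (Pf t).
Qed.

Lemma card_bound_of_cover (X : Type) (k : nat) (I : finType) (F : I -> X)
    (f : nat -> X) :
  (forall i j, i < k -> j < k -> f i = f j -> i = j) ->
  (forall i, i < k -> exists c, F c = f i) -> k <= #|I|.
Proof.
move=> finj cov.
have /fin_all_exists [g gF] : forall i : 'I_k, exists c, F c = f i.
  by move=> i; apply: cov.
rewrite -[k]card_ord; apply: (@leq_card _ _ g) => i j gij.
by apply/val_inj/finj; rewrite ?ltn_ord // -!gF gij.
Qed.

(** If no enumeration covered [P], new elements could be appended until [N.+1] distinct ones were
    found. This turns the counting form of bounded indegree into an enumeration over a fixed index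
    type, with arbitrary spare slots. *)
Lemma cover_of_no_injection (X : Type) (x0 : X) (N : nat) (P : X -> Prop) :
  (forall xs : 'I_N.+1 -> X, (forall i, P (xs i)) ->
     exists i j, i != j /\ xs i = xs j) ->
  exists f : 'I_N.+1 -> X, forall x, P x -> exists i, f i = x.
Proof.
move=> noinj; apply: NNPP => nocov.
have grow : forall k, k <= N.+1 -> exists g : nat -> X,
    (forall i, i < k -> P (g i)) /\
    (forall i j, i < k -> j < k -> g i = g j -> i = j).
  elim=> [|k IHk] kN; first by exists (fun=> x0).
  have [g [gP ginj]] := IHk (ltnW kN).
  have [[x [Px xnew]]|none] := classic (exists x, P x /\ forall i, i < k -> g i <> x).
    exists (fun i => if i == k then x else g i); split.
      by move=> i; case: eqP => // ? ?; apply: gP; lia.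
    move=> i j ik jk; case: eqP => ei; case: eqP => ej; try lia.
    - by move/esym/xnew; lia.
    - by move/xnew; lia.
    - by apply: ginj; lia.
  case: nocov; exists (fun i => g i) => x Px; apply: NNPP => nx.
  apply: none; exists x; split=> // i ik gix; apply: nx.
  by exists (Ordinal (ltn_trans ik kN)).
have [g [gP ginj]] := grow _ (leqnn _).
have [|i [j [nij gij]]] := noinj (fun i => g i); first by move=> i; apply: gP.
by case/eqP: nij; apply/val_inj; apply: ginj (ltn_ord i) (ltn_ord j) gij.
Qed.

(** * Geodesics in thin triangles *)

Section Words.
Variables (M : Type) (mul : M -> M -> M) (one : M).
Hypothesis monoid_mul : is_monoid mul one.
Local Notation "x ** y" := (mul x y) (at level 40, left associativity).

Let mulA x y z : x ** (y ** z) = x ** y ** z.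
Proof. by case: monoid_mul => ->. Qed.
Let mul1 x : one ** x = x. Proof. by case: monoid_mul => _ [->]. Qed.
Let mulx1 x : x ** one = x. Proof. by case: monoid_mul => _ [_ ->]. Qed.

Lemma evalw_cat (A : Type) (gen : A -> M) (u v : seq A) :
  evalw mul one gen (u ++ v) = evalw mul one gen u ** evalw mul one gen v.
Proof.
rewrite /evalw foldl_cat; move: (foldl _ one u) => x.
elim/last_ind: v => [|v a IHv]; first by rewrite mulx1.
by rewrite -cats1 !foldl_cat /= IHv mulA.
Qed.

Lemma evalw1 (A : Type) (gen : A -> M) a : evalw mul one gen [:: a] = gen a.
Proof. exact: mul1. Qed.

Lemma evalw_cons (A : Type) (gen : A -> M) a (u : seq A) :
  evalw mul one gen (a :: u) = gen a ** evalw mul one gen u.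
Proof. by rewrite -cat1s evalw_cat evalw1. Qed.

Lemma evalw_rcons (A : Type) (gen : A -> M) (u : seq A) a :
  evalw mul one gen (rcons u a) = evalw mul one gen u ** gen a.
Proof. by rewrite -cats1 evalw_cat evalw1. Qed.

(** Hyperbolicity, bounded indegree and the input words come with different generating sets; passing
    between them costs only a linear factor. *)
Lemma evalw_translate (A B : Type) (genA : A -> M) (genB : B -> M) (c : nat) :
  (forall a, exists w, size w <= c /\ evalw mul one genB w = genA a) ->
  forall u, exists w,
    size w <= c * size u /\ evalw mul one genB w = evalw mul one genA u.
Proof.
move=> hc; elim=> [|a u [w [sw ew]]]; first by exists [::].
have [w' [sw' ew']] := hc a; exists (w' ++ w); split; first by rewrite size_cat /=; nia.
by rewrite evalw_cat evalw_cons ew ew'.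
Qed.

Lemma generates_bounded (A : finType) (f : A -> M) (B : Type) (gen : B -> M) :
  generates mul one gen ->
  exists c, forall a, exists w, size w <= c /\ evalw mul one gen w = f a.
Proof.
move=> gens; apply: finite_bound => [a m n mn [w [sw ew]]|a].
  by exists w; split=> //; apply: leq_trans mn.
by have [w ew] := gens (f a); exists (size w), w.
Qed.

Lemma dist_le_refl (A : Type) (gen : A -> M) x n : dist_le mul one gen x x n.
Proof. by exists [::]; rewrite mulx1. Qed.

Lemma dist_le_mono (A : Type) (gen : A -> M) x y m n :
  m <= n -> dist_le mul one gen x y m -> dist_le mul one gen x y n.
Proof. by move=> mn [w [sw ew]]; exists w; split=> //; apply: leq_trans mn. Qed.

Lemma dist_le_trans (A : Type) (gen : A -> M) y x z m n :
  dist_le mul one gen x y m -> dist_le mul one gen y z n ->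
  dist_le mul one gen x z (m + n).
Proof.
move=> [u [su eu]] [v [sv ev]]; exists (u ++ v).
by rewrite size_cat evalw_cat mulA eu ev; split=> //; lia.
Qed.

Lemma dist_le_take (A : Type) (gen : A -> M) (w : seq A) i j : i <= j ->
  dist_le mul one gen (evalw mul one gen (take i w)) (evalw mul one gen (take j w))
    (j - i).
Proof.
move=> ij; exists (take (j - i) (drop i w)); split; first by rewrite size_take; case: ltnP; lia.
by rewrite -evalw_cat -takeD subnKC.
Qed.

(* [F x] enumerates the in-ball of radius [n] around [x], over an index type
   independent of [x]. *)
Lemma in_ball_enum_of_indegree (A : finType) (gen : A -> M) :
  bounded_indegree_wrt mul gen -> forall n,
  exists (I : finType) (F : M -> I -> M),
    forall t x, dist_le mul one gen t x n -> exists i, F x i = t.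
Proof.
move=> [alpha fib].
have [F FP] : exists F : A * M -> 'I_alpha.+1 -> M,
    forall ar x, x ** gen ar.1 = ar.2 -> exists i, F ar i = x.
  apply: (choice (fun ar (f : 'I_alpha.+1 -> M) =>
    forall x, x ** gen ar.1 = ar.2 -> exists i, f i = x)) => -[a r] /=.
  apply: (cover_of_no_injection one) => xs xsP; apply: (fib a) => i j.
  by rewrite !xsP.
elim=> [|n [I [G GP]]].
  exists unit, (fun x _ => x) => t x [w [sw ew]]; exists tt.
  by move: ew; rewrite (size0nil (_ : size w = 0)) ?mulx1 //; lia.
(* [None] is the empty path; otherwise [i] names the second vertex of the path and [(a, j)] its
   predecessor [t] along [a]. *)
exists (option (I * (A * 'I_alpha.+1))%type), (fun x o =>
  if o is Some (i, (a, j)) then F (a, G x i) j else x) => t x [[|a w] [sw]].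
  by rewrite mulx1 => <-; exists None.
rewrite evalw_cons mulA => ew.
have [|i Gi] := GP (t ** gen a) x; first by exists w.
have [j Fj] := FP (a, t ** gen a) t erefl.
by exists (Some (i, (a, j))); rewrite Gi.
Qed.

Lemma in_ball_enum (B : finType) (gen : B -> M) (n : nat) :
  bounded_indegree mul one ->
  exists (I : finType) (F : M -> I -> M),
    forall t x, dist_le mul one gen t x n -> exists i, F x i = t.
Proof.
move=> [A [genA [gensA indeg]]].
have [c hc] := generates_bounded gen gensA.
have [I [F FP]] := in_ball_enum_of_indegree indeg (c * n).
exists I, F => t x [w [sw ew]]; apply: FP.
have [w' [sw' ew']] := evalw_translate hc w.
by exists w'; rewrite ew' ew; split=> //; nia.
Qed.

Definition shortest (A : Type) (gen : A -> M) (w : seq A) : Prop :=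
  forall w', evalw mul one gen w' = evalw mul one gen w -> size w <= size w'.

Lemma shortest_exists (A : Type) (gen : A -> M) (w : seq A) :
  exists r, [/\ shortest gen r, evalw mul one gen r = evalw mul one gen w
    & size r <= size w].
Proof.
have [n] := ubnP (size w); elim: n w => // n IHn w wn.
have [sh|nsh] := classic (shortest gen w); first by exists w.
have [w' nw'] := not_all_ex_not _ _ nsh.
have [ew' lw'] := imply_to_and _ _ nw'.
have [|r [shr er sr]] := IHn w'; first by lia.
by exists r; split=> //; [rewrite er | lia].
Qed.

Lemma shortest_take (A : Type) (gen : A -> M) (w : seq A) i :
  shortest gen w -> shortest gen (take i w).
Proof.
move=> sh w' ew'; have := sh (w' ++ drop i w).
rewrite evalw_cat ew' -evalw_cat cat_take_drop size_cat => /(_ erefl).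
by rewrite -{1}(cat_take_drop i w) size_cat; lia.
Qed.

Lemma shortest_index_le (A : Type) (gen : A -> M) (w v : seq A) i n :
  shortest gen w -> i <= size w ->
  dist_le mul one gen (evalw mul one gen v) (evalw mul one gen (take i w)) n ->
  i <= size v + n.
Proof.
move=> sh iw [u [su eu]]; have := @shortest_take _ gen w i sh (v ++ u).
by rewrite evalw_cat eu size_takel // size_cat => /(_ erefl); lia.
Qed.

Lemma shortest_take_inj (A : Type) (gen : A -> M) (w : seq A) i j :
  shortest gen w -> i <= size w -> j <= size w ->
  evalw mul one gen (take i w) = evalw mul one gen (take j w) -> i = j.
Proof.
move=> sh iw jw eij; apply/eqP; rewrite eqn_leq.
have := @shortest_take _ gen w i sh _ (esym eij).
have := @shortest_take _ gen w j sh _ eij.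
by rewrite !size_takel // => -> ->.
Qed.

Hypothesis cancel_mul : left_cancellative mul.

(** Cancellation pulls any competing path from [x] back to a path from [one], so being a geodesic
    does not depend on the start. *)
Lemma shortest_geodesic (A : Type) (gen : A -> M) x (w : seq A) :
  shortest gen w -> geodesic mul one gen x w.
Proof. by move=> sh w' /cancel_mul /sh. Qed.

(** * Length bounds and fellow travelling from thin triangles *)

Section Hyperbolic.
Variables (B : finType) (gen : B -> M) (delta : nat).
Hypothesis gens : generates mul one gen.
Hypothesis hyp : strongly_delta_hyperbolic mul one gen delta.
Hypothesis indeg : bounded_indegree mul one.
Local Notation ev := (evalw mul one gen).
Local Notation dle := (dist_le mul one gen).
Local Notation sh := (shortest gen).

Lemma thin_triangle p q r : sh p -> sh q -> sh r -> ev r = ev p ** ev q ->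
  [/\ forall i, i <= size r ->
        (exists2 j, j <= size p & dle (ev (take j p)) (ev (take i r)) delta) \/
        (exists2 j, j <= size q &
          dle (ev (take i r)) (ev p ** ev (take j q)) delta),
      forall i, i <= size p ->
        (exists2 j, j <= size r & dle (ev (take j r)) (ev (take i p)) delta) \/
        (exists2 j, j <= size q &
          dle (ev (take i p)) (ev p ** ev (take j q)) delta)
    & forall i, i <= size q ->
        (exists2 j, j <= size p &
          dle (ev (take j p)) (ev p ** ev (take i q)) delta) \/
        (exists2 j, j <= size r &
          dle (ev p ** ev (take i q)) (ev (take j r)) delta)].
Proof.
move=> shp shq shr er.
have [|tr [tp tq]] := hyp (x := one) (u := p) (v := q) (w := r).
  split; first exact: shortest_geodesic.
  split; first exact: shortest_geodesic.
  split; first exact: shortest_geodesic.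
  by rewrite /path_end !mul1.
split=> i ile.
- have [|[z [[j [jle ->]]]]|[z [[j [jle ->]]]]] := tr (ev (take i r)).
  + by exists i; rewrite mul1.
  + by rewrite mul1; left; exists j.
  + by rewrite /path_end mul1; right; exists j.
- have [|[z [[j [jle ->]]]]|[z [[j [jle ->]]]]] := tp (ev (take i p)).
  + by exists i; rewrite mul1.
  + by rewrite mul1; left; exists j.
  + by rewrite /path_end mul1; right; exists j.
- have [|[z [[j [jle ->]]]]|[z [[j [jle ->]]]]] := tq (ev p ** ev (take i q)).
  + by exists i; rewrite /path_end mul1.
  + by rewrite mul1; left; exists j.
  + by rewrite mul1; right; exists j.
Qed.

(** Pigeonhole: out-balls are bounded by the number of short words, in-balls by the indegree, so
    each [g j] or [h j] accounts for boundedly many [f i]. *)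
Lemma length_bound_of_balls : exists S, forall (f g h : nat -> M) (k m n : nat),
  (forall i j, i <= k -> j <= k -> f i = f j -> i = j) ->
  (forall i, i <= k ->
     (exists2 j, j <= m & dle (g j) (f i) delta) \/
     (exists2 j, j <= n & dle (f i) (h j) delta)) ->
  k < S * (m.+1 + n.+1).
Proof.
have [I [F FP]] := in_ball_enum gen delta indeg.
exists (#|{: delta.-bseq B}| + #|I|) => f g h k m n finj fcov.
pose G (c : 'I_m.+1 * delta.-bseq B + 'I_n.+1 * I) :=
  match c with
  | inl (j, w) => g j ** ev w
  | inr (j, i) => F (h j) i
  end.
have := @card_bound_of_cover M k.+1 _ G f finj.
rewrite card_sum !card_prod !card_ord => cb.
apply: leq_trans (cb _) _; last by rewrite mulnDl [_ * #|I|]mulnC [_ * #|_|]mulnC leq_add // leq_mul2l; lia.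
move=> i ik; have [|[j jm [w [sw ew]]]|[j jn /FP [c Fc]]] := fcov i; first by [].
  by exists (inl (Ordinal (jm : j < m.+1), Bseq sw)).
by exists (inr (Ordinal (jn : j < n.+1), c)).
Qed.

Lemma factor_length_bound : exists S, forall x y m n,
  (x = y ** m \/ x = m ** y) -> dle one x n -> dle one y n -> dle one m (S * n.+1).
Proof.
have [S SP] := length_bound_of_balls.
(* Two, because both other sides have at most [n.+1] vertices. *)
exists (S * 2) => x y m n xym [u [su eu]] [v [sv ev']].
rewrite mul1 in eu; rewrite mul1 in ev'.
have [r [shr er sr]] := shortest_exists gen u.
have [p [shp ep sp]] := shortest_exists gen v.
have [w ew] := gens m; have [q [shq eq _]] := shortest_exists gen w.
exists q; rewrite mul1 eq ew; split=> //.
case: xym => xym.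
- have [|_ _ tq] := thin_triangle shp shq shr; first by rewrite er ep eq eu ev' ew.
  suff : size q < S * ((size p).+1 + (size r).+1) by nia.
  apply: (SP (fun i => ev p ** ev (take i q)) _ _ _ _ _ _ tq) => i j iq jq.
  by move/cancel_mul; apply: shortest_take_inj.
(* A left factor labels the first side of the triangle, so here the second clause of thinness
   applies. *)
- have [|_ tp _] := thin_triangle shq shp shr; first by rewrite er ep eq eu ev' ew.
  suff : size q < S * ((size r).+1 + (size p).+1) by nia.
  apply: (SP (fun i => ev (take i q)) _ (fun j => _) _ _ _ _ tp) => i j iq jq.
  exact: shortest_take_inj.
Qed.

(** If [y] reaches [x] at all, the short word [w] from [x] to [y] is right invertible. Its right
    inverse is unique by cancellation, and there are finitely many such [w]. *)
Lemma return_bound : exists K, forall x y n,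
  dle x y delta -> dle y x n -> dle y x K.
Proof.
have [K KP] : exists K, forall w : delta.-bseq B,
    forall f, ev w ** f = one -> dle one f K.
  apply: finite_bound => [w m n mn wP f /wP|w]; first exact: dist_le_mono.
  have [[f wf]|none] := classic (exists f, ev w ** f = one); last first.
    by exists 0 => f wf; case: none; exists f.
  have [v ev_v] := gens f; exists (size v) => f' wf'.
  by exists v; rewrite mul1 ev_v; split=> //; apply: (@cancel_mul (ev w)); rewrite wf wf'.
exists K => x y n [w [sw xw]] [v [sv yv]].
have wv : ev w ** ev v = one by apply: (@cancel_mul x); rewrite mulA xw yv mulx1.
have [u [su eu]] := KP (Bseq sw) _ wv.
by exists u; rewrite -yv -eu mul1.
Qed.

(* A vertex [p_i] is close to some [r_j] unless it is one of the boundedly many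
   vertices in the in-ball of [r]'s endpoint.  If [r_j -> p_i] is short but [j]
   is much larger than [i], then [p_i] also reaches [r_j], so by [return_bound]
   it does so within a bounded distance, which contradicts the size of [j]. *)
Lemma fellow_travel s : exists D K, forall p q r,
  sh p -> sh q -> sh r -> size q <= s -> ev r = ev p ** ev q ->
  size p <= size r + D /\
  forall i, i <= size p -> dle (ev (take (i - D) r)) (ev (take i p)) K.
Proof.
have [K0 K0P] := return_bound.
have [I [F FP]] := in_ball_enum gen (delta + s) indeg.
(* [S] bounds the in-ball of the endpoint of [r]; [E] will bound [j - i] when [r_j -> p_i] is short.
   The final distance adds the legs [r_(i-D) -> r_j -> p_i0 -> p_i], where [i0] is at most [S]
   behind [i]. *)
pose S := #|I|; pose E := K0 + delta + delta + s + 1.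
exists (delta + S), (S + S + E + delta + delta + delta) => p q r shp shq shr qs er.
have [tr tp _] := thin_triangle shp shq shr er.
have to_end x j : dle x (ev p ** ev (take j q)) delta -> dle x (ev r) (delta + s).
  move=> dx; have [jq|/ltnW jq] := leqP j (size q); last first.
    by apply: dist_le_mono (leq_addr _ _) _; rewrite er -(take_oversize jq).
  apply: dist_le_trans dx _; exists (drop j q); split; first by rewrite size_drop; lia.
  by rewrite er -mulA -evalw_cat cat_take_drop.
have index_r j n : j <= size r -> dle (ev (take j r)) (ev r) n -> size r <= j + n.
  move=> jr; rewrite -{2}(take_size r) => /(shortest_index_le shr (leqnn _)).
  by rewrite size_takel.
pose close i := exists2 j, j <= size r & dle (ev (take j r)) (ev (take i p)) delta.
have closeP i : i <= size p -> close i -> exists2 j, j <= size r &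
    [/\ dle (ev (take j r)) (ev (take i p)) delta, i <= j + delta & j <= i + E].
  move=> ip [j jr dj]; exists j => //; split=> //.
    by rewrite -[X in _ <= X + _](size_takel jr); apply: shortest_index_le dj.
  rewrite leqNgt; apply/negP => far.
  (* The cut-off keeps [r_j'] from reaching the end of [r] within [delta + s], so thinness puts it
     in the out-ball of some [p_j2]. As [j2] exceeds [i], this gives a path
     [p_i -> p_j2 -> r_j' -> r_j]. *)
  pose j' := minn j (size r - (delta + s + 1)).
  have [|[j2 j2p d2]|[t tq /to_end /index_r]] := tr j'; last 2 first.
  - have lej' : j' <= j2 + delta.
      by rewrite -[X in _ <= X + _](size_takel j2p); apply: shortest_index_le d2; rewrite // /j'; lia.
    have dpr : dle (ev (take i p)) (ev (take j r)) ((j2 - i) + (delta + (j - j'))).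
      apply: dist_le_trans (dist_le_take gen p _) _; first by rewrite /j' in lej' *; lia.
      by apply: dist_le_trans d2 (dist_le_take gen r _); rewrite /j'; lia.
    have := K0P _ _ _ dj dpr => /(shortest_index_le shr jr).
    by rewrite size_takel //; rewrite /E in far; lia.
  - by rewrite /j'; lia.
  - by rewrite /j' /E in far *; lia.
(* The [S.+1] vertices from [p_(i-S)] to [p_i] are distinct, so they cannot all lie in the in-ball
   enumerated by [F (ev r)]. *)
have close_back i : i <= size p -> S <= i -> exists2 i0, i - S <= i0 <= i & close i0.
  move=> ip Si; apply: NNPP => none.
  suff : S.+1 <= #|I| by rewrite /S; lia.
  apply: (@card_bound_of_cover M _ I (F (ev r)) (fun k => ev (take (i - k) p))).
    by move=> k l kS lS /(shortest_take_inj shp); lia.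
  move=> k kS; apply: FP; have [||[j _ /to_end //]] := tp (i - k); first by lia.
  by move=> ck; case: none; exists (i - k) => //; lia.
split.
  have [|Sp] := leqP S (size p); last by lia.
  move=> /(close_back _ (leqnn _)) [i0 i0p /closeP [|j jr [_ ? _]]]; lia.
(* For [i < S] the vertex of [r] is [one], and the prefix of [p] itself is a short connecting
   path. *)
move=> i ip; have [|iS] := leqP S i; last first.
  exists (take i p); rewrite (_ : i - (delta + S) = 0); last by lia.
  by rewrite take0 mul1 size_takel //; split=> //; lia.
move=> /(close_back _ ip) [i0 i0i /closeP [|j jr [dj ij ji]]]; first by lia.
have := dist_le_trans (dist_le_take gen r (_ : i - (delta + S) <= j))
  (dist_le_trans dj (dist_le_take gen p (_ : i0 <= i))).
by move=> dd; apply: dist_le_mono (dd _ _); lia.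
Qed.

End Hyperbolic.
End Words.

(** * The verifying Turing machine *)

(** The arguments of [GoRight] and [GoLeft] are the symbol to write in the crossed cell and the new
    carried symbol; that of [Guess] is the new carried symbol. *)
Inductive instr (X : Type) :=
  | GoRight of X & X | GoLeft of X & X | Guess of X | Finish.
Arguments Finish {X}.

Definition instr_code X (i : instr X) : (X * X) + (X * X) + (X + unit) :=
  match i with
  | GoRight h k => inl (inl (h, k))
  | GoLeft h k => inl (inr (h, k))
  | Guess k => inr (inl k)
  | Finish => inr (inr tt)
  end.
Definition instr_decode X (c : (X * X) + (X * X) + (X + unit)) : instr X :=
  match c with
  | inl (inl (h, k)) => GoRight h k
  | inl (inr (h, k)) => GoLeft h k
  | inr (inl k) => Guess k
  | inr (inr _) => Finish
  end.
Lemma instr_codeK X : cancel (@instr_code X) (@instr_decode X).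
Proof. by case. Qed.
HB.instance Definition _ (X : finType) :=
  Finite.copy (instr X) (can_type (@instr_codeK X)).

(** The flag of [Scan] tells whether the separator has been read. [Fetch] and [Back] hold the
    carried symbol and the current instruction. [AtLeft] holds the old carried symbol, the symbol to
    write and the new carried symbol. *)
Inductive state (X : Type) :=
  | Scan of bool
  | Fetch of X & instr X
  | Back of X & instr X
  | AtLeft of X & X & X
  | AtRight of X
  | Check | Accept | Reject.
Arguments Scan {X}. Arguments Check {X}. Arguments Accept {X}. Arguments Reject {X}.

Definition state_code X (q : state X) :
    (bool + X * instr X) + (X * instr X + X * X * X) + (X + 'I_3) :=
  match q with
  | Scan b => inl (inl (inl b))
  | Fetch k i => inl (inl (inr (k, i)))
  | Back k i => inl (inr (inl (k, i)))
  | AtLeft k h k' => inl (inr (inr (k, h, k')))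
  | AtRight k => inr (inl k)
  | Check => inr (inr (inord 0))
  | Accept => inr (inr (inord 1))
  | Reject => inr (inr (inord 2))
  end.
Definition state_decode X
    (c : (bool + X * instr X) + (X * instr X + X * X * X) + (X + 'I_3)) : state X :=
  match c with
  | inl (inl (inl b)) => Scan b
  | inl (inl (inr (k, i))) => Fetch k i
  | inl (inr (inl (k, i))) => Back k i
  | inl (inr (inr (k, h, k'))) => AtLeft k h k'
  | inr (inl k) => AtRight k
  | inr (inr j) =>
      match nat_of_ord j with 0 => Check | 1 => Accept | _ => Reject end
  end.
Lemma state_codeK X : cancel (@state_code X) (@state_decode X).
Proof. by case=> //=; rewrite inordK. Qed.
HB.instance Definition _ (X : finType) :=
  Finite.copy (state X) (can_type (@state_codeK X)).

(* [Raw] holds the symbols of the input and of the certificate; in [Cell] and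
   [End] the boolean marks the position of the simulated head. *)
Inductive symbol (A X : Type) :=
  | Raw of option A + bool
  | Blank
  | Cell of bool & X
  | End of bool
  | Used.
Arguments Raw {A X}. Arguments Blank {A X}. Arguments Cell {A X}.
Arguments End {A X}. Arguments Used {A X}.

Definition symbol_code A X (g : symbol A X) :
    (option A + bool) + (bool * X) + option (option bool) :=
  match g with
  | Raw s => inl (inl s)
  | Cell b x => inl (inr (b, x))
  | Blank => inr None
  | Used => inr (Some None)
  | End b => inr (Some (Some b))
  end.
Definition symbol_decode A X
    (c : (option A + bool) + (bool * X) + option (option bool)) : symbol A X :=
  match c with
  | inl (inl s) => Raw s
  | inl (inr (b, x)) => Cell b x
  | inr None => Blank
  | inr (Some None) => Used
  | inr (Some (Some b)) => End b
  end.
Lemma symbol_codeK A X : cancel (@symbol_code A X) (@symbol_decode A X).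
Proof. by case. Qed.
HB.instance Definition _ (A X : finType) :=
  Finite.copy (symbol A X) (can_type (@symbol_codeK A X)).

(* Instructions are written in unary: reading [false] steps to the next one, and
   reading [true] executes the current one. *)
Definition next_instr (X : finType) (i : instr X) : instr X :=
  enum_val (ordS (enum_rank i)).

(** The successor is cyclic on ranks, so the rank difference modulo [N] suffices. This bounds the
    unary code of an instruction. *)
Lemma next_instr_reach (X : finType) (i j : instr X) :
  exists2 n, n <= #|{: instr X}| & iter n (@next_instr X) i = j.
Proof.
pose N := #|{: instr X}|; rewrite -/N.
have rank_iter n : val (enum_rank (iter n (@next_instr X) i)) = (enum_rank i + n) %% N.
  elim: n => [|n IHn]; first by rewrite addn0 modn_small // ltn_ord.
  by rewrite iterS /next_instr enum_valK /= IHn -addn1 modnDml addn1 addnS.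
have lti : enum_rank i < N := ltn_ord _; have ltj : enum_rank j < N := ltn_ord _.
have solve n : (enum_rank i + n) %% N = enum_rank j -> iter n (@next_instr X) i = j.
  by move=> e; apply/enum_rank_inj/val_inj; rewrite rank_iter.
have [le_ij|lt_ji] := leqP (enum_rank i) (enum_rank j).
  exists (enum_rank j - enum_rank i); first by rewrite (leq_trans (leq_subr _ _)) // ltnW.
  by apply: solve; rewrite subnKC // modn_small.
exists (N + enum_rank j - enum_rank i).
  by rewrite leq_subLR addnC leq_add2r ltnW.
by apply: solve; rewrite subnKC ?modnDl ?modn_small // ltnW // ltn_addr.
Qed.

(** * Transition table and runs of the verifier *)

Section Machine.
Variables (A X : finType) (loadU loadV : A -> X) (x1 : X).
Variables (swap : X -> X -> X -> X -> bool) (fresh : pred X) (guess : rel X).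
Variable (fin : pred X).

(* The sentinel [End true] written at the end of the scan overwrites the first
   bit of the certificate, if there is one. *)
Definition verifier_delta (q : state X) (g : symbol A X) : state X * symbol A X * move :=
  match q, g with
  | Scan b, Raw (inl (Some a)) =>
      (Scan b, Cell false (if b then loadV a else loadU a), MoveR)
  | Scan false, Raw (inl None) => (Scan true, Cell false x1, MoveR)
  | Scan true, Raw (inr _) | Scan true, Blank => (Fetch x1 Finish, End true, Stay)
  | Fetch k i, Raw (inr true) => (Back k i, Used, MoveL)
  | Fetch k i, Raw (inr false) => (Fetch k (next_instr i), Used, MoveR)
  | Fetch k i, Cell _ _ | Fetch k i, End _ | Fetch k i, Used => (q, g, MoveR)
  | Back k (GoRight h' k'), Cell true h =>
      if swap k h h' k' then (AtRight k', Cell false h', MoveR) else (Reject, g, Stay)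
  | Back k (GoLeft h' k'), Cell true h => (AtLeft k h' k', Cell false h, MoveL)
  | Back k (GoLeft h' k'), End true => (AtLeft k h' k', End false, MoveL)
  | Back k (Guess k'), End true =>
      if guess k k' then (Fetch k' Finish, g, Stay) else (Reject, g, Stay)
  | Back k Finish, End true =>
      if fin k then (Check, g, MoveL) else (Reject, g, Stay)
  | Back k i, Cell false _ | Back k i, End false | Back k i, Used => (q, g, MoveL)
  | AtLeft k h' k', Cell _ h =>
      if swap k' h' h k then (Fetch k' Finish, Cell true h', Stay)
      else (Reject, g, Stay)
  | AtLeft k h' k', Blank =>
      if [exists h, fresh h && swap k' h' h k] then
        (Fetch k' Finish, Cell true h', Stay)
      else (Reject, g, Stay)
  | AtRight k, Cell _ h => (Fetch k Finish, Cell true h, Stay)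
  | AtRight k, End _ => (Fetch k Finish, End true, Stay)
  | Check, Cell _ h => if fin h then (Check, g, MoveL) else (Reject, g, Stay)
  | Check, Blank => (Accept, g, Stay)
  | _, _ => (Reject, g, Stay)
  end.

Definition verifier : TM (option A + bool) :=
  {| tm_state := state X; tm_gamma := symbol A X; tm_blank := Blank;
     tm_inj := Raw; tm_start := Scan false; tm_accept := Accept;
     tm_reject := Reject; tm_delta := verifier_delta |}.

Local Notation cfg := (config verifier).
Local Notation step := (@tm_step _ verifier).

(** An empty [t] means a blank under the head, so the step lemmas need no case for the end of the
    tape. *)
Definition at_tape (q : state X) (l t : seq (symbol A X)) : cfg :=
  (q, l, head Blank t, behead t).
Definition at_left (q : state X) (l t : seq (symbol A X)) : cfg :=
  at_tape q (behead l) (head Blank l :: t).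

Local Arguments tm_step : simpl never.
Local Arguments at_tape : simpl never.
Local Arguments at_left : simpl never.

Lemma init_configE s : init_config verifier s = at_tape (Scan false) [::] (map Raw s).
Proof. by case: s. Qed.

Definition halting (q : state X) := (q == Accept) || (q == Reject).

Lemma haltingE q :
  halting q = match q with Accept | Reject => true | _ => false end.
Proof.
rewrite /halting.
by case: q => *; try (by rewrite eqxx ?orbT); apply/negbTE/norP; split; apply/eqP.
Qed.

Lemma step_right q l h t q' g : halting q = false -> verifier_delta q h = (q', g, MoveR) ->
  step (at_tape q l (h :: t)) = at_tape q' (g :: l) t.
Proof. by rewrite /halting /tm_step /= => -> ->; case: t. Qed.

Lemma step_left q l h t q' g : halting q = false -> verifier_delta q h = (q', g, MoveL) ->
  step (at_tape q l (h :: t)) = at_left q' l (g :: t).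
Proof. by rewrite /halting /tm_step /= => -> ->; case: l. Qed.

Lemma step_stay q l h t q' g : halting q = false -> verifier_delta q h = (q', g, Stay) ->
  step (at_tape q l (h :: t)) = at_tape q' l (g :: t).
Proof. by rewrite /halting /tm_step /= => -> ->. Qed.

Lemma step_halted q l t : halting q -> step (at_tape q l t) = at_tape q l t.
Proof. by rewrite /halting /tm_step /= => ->. Qed.

Lemma at_tape_nil q l : at_tape q l [::] = at_tape q l [:: Blank].
Proof. by []. Qed.

Definition accepting (c : cfg) : Prop := exists t, (iter t step c).1.1.1 = Accept.

Lemma accept_stays (c : cfg) n : c.1.1.1 = Accept -> (iter n step c).1.1.1 = Accept.
Proof.
case: c => [[[q l] h] r] /= ->; elim: n => // n IHn.
by rewrite iterSr /tm_step /= eqxx.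
Qed.

Lemma accept_mono (c : cfg) m n : m <= n ->
  (iter m step c).1.1.1 = Accept -> (iter n step c).1.1.1 = Accept.
Proof. by move=> mn acc; rewrite -(subnK mn) iterD; apply: accept_stays. Qed.

Lemma accepting_iter n (c : cfg) : accepting c -> accepting (iter n step c).
Proof.
move=> [t acc]; exists t; rewrite -iterD.
by apply: accept_mono acc; apply: leq_addr.
Qed.

Lemma accepting_step (c c' : cfg) : step c = c' -> accepting c -> accepting c'.
Proof. by move=> <-; apply: (accepting_iter 1). Qed.

Lemma not_accepting_reject l t : ~ accepting (at_tape Reject l t).
Proof.
move=> [n]; suff -> : iter n step (at_tape Reject l t) = at_tape Reject l t by [].
by elim: n => // n IHn; rewrite iterS IHn step_halted ?haltingE.
Qed.

Lemma not_accepting_stuck q l h t : halting q = false ->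
  verifier_delta q h = (Reject, h, Stay) -> ~ accepting (at_tape q l (h :: t)).
Proof.
by move=> nq dq /(accepting_step (step_stay l t nq dq)) /not_accepting_reject.
Qed.

Definition passable (g : symbol A X) :=
  match g with Raw _ | Blank => false | _ => true end.
Definition unmarked (g : symbol A X) :=
  match g with Cell b _ | End b => ~~ b | Used => true | _ => false end.

Lemma fetch_pass k i l s t : all passable s ->
  iter (size s) step (at_tape (Fetch k i) l (s ++ t)) =
  at_tape (Fetch k i) (catrev s l) t.
Proof.
elim: s l => // g s IHs l /= /andP [pg ps]; rewrite -iterS iterSr.
rewrite (@step_right _ _ _ _ (Fetch k i) g) ?IHs //.
by case: g pg.
Qed.

Lemma fetch_false k i n l t :
  iter n step (at_tape (Fetch k i) l (nseq n (Raw (inr false)) ++ t)) =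
  at_tape (Fetch k (iter n (@next_instr X) i)) (catrev (nseq n Used) l) t.
Proof.
elim: n i l => // n IHn i l; rewrite iterSr [nseq n.+1 _]/= cat_cons.
by rewrite (@step_right _ _ _ _ (Fetch k (next_instr i)) Used) // IHn -iterSr.
Qed.

Lemma back_pass k i l s t : all unmarked s ->
  iter (size s) step (at_left (Back k i) (catrev s l) t) = at_left (Back k i) l (s ++ t).
Proof.
elim: s l => // g s IHs l /andP [ug us].
rewrite [size _]/= iterS [catrev _ _]/= IHs //.
rewrite (_ : at_left _ (g :: l) _ = at_tape (Back k i) l (g :: s ++ t)) //.
by apply: step_left => //; case: g ug => [x||[] x|[]|] // _; case: (i).
Qed.

Definition marked_right (R : seq X) : seq (symbol A X) :=
  if R is h :: R' then Cell true h :: map (Cell false) R' ++ [:: End false]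
  else [:: End true].

(** The configuration between two instructions: the head is on the mark, and [j] certificate cells
    are already consumed. *)
Definition start_cfg (z : seq X * X * seq X) (j : nat) (bits : seq bool) : cfg :=
  at_tape (Fetch z.1.2 Finish) (map (Cell false) z.1.1)
    (marked_right z.2 ++ nseq j Used ++ map (Raw \o inr) bits).

Lemma marked_rightE R : exists g s, [/\ marked_right R = g :: s, size s = size R,
  passable g, all passable s & all unmarked s].
Proof.
case: R => [|h R]; first by exists (End true), [::].
exists (Cell true h), (map (Cell false) R ++ [:: End false]); split=> //.
- by rewrite size_cat size_map addn1.
- by rewrite all_cat all_map /= andbT; apply/allP.
- by rewrite all_cat all_map /= andbT; apply/allP.
Qed.

Lemma fetch_cycle L k R j n bits :
  iter (2 * (size R + j + n) + 2) step
    (start_cfg (L, k, R) j (nseq n false ++ true :: bits)) =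
  at_tape (Back k (iter n (@next_instr X) Finish)) (map (Cell false) L)
    (marked_right R ++ nseq (j + n).+1 Used ++ map (Raw \o inr) bits).
Proof.
have [g [s [eR sR pg ps us]]] := marked_rightE R; rewrite -sR.
rewrite /start_cfg eR /= map_cat map_nseq /=; set rest := map _ bits.
set i := iter n _ Finish; set l := map _ L.
have fetched : iter (n + size (g :: s ++ nseq j Used)) step (at_tape (Fetch k Finish) l
    (g :: s ++ nseq j Used ++ nseq n (Raw (inr false)) ++ Raw (inr true) :: rest)) =
    at_tape (Fetch k i) (catrev (s ++ nseq j Used ++ nseq n Used) (g :: l))
      (Raw (inr true) :: rest).
  rewrite iterD catA -cat_cons fetch_pass; last by rewrite /= pg all_cat ps all_nseq orbT.
  by rewrite fetch_false -catrev_catl /= -catA.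
(* Outward the head passes the marked symbol and [size R + j + n] more; one step turns on [true],
   and the same cells except the marked one are passed back. *)
rewrite (_ : 2 * _ + 2 = size (s ++ nseq j Used ++ nseq n Used) +
  (n + size (g :: s ++ nseq j Used)).+1); last by rewrite /= !size_cat !size_nseq; lia.
rewrite iterD iterS fetched (@step_left _ _ _ _ (Back k i) Used) //.
rewrite back_pass; last by rewrite !all_cat us !all_nseq !orbT.
rewrite /at_left /= -!catA [in LHS](catA (nseq j _)) -nseqD.
by have -> : forall m, nseq m Used ++ Used :: rest = Used :: nseq m Used ++ rest
  by elim=> //= m ->.
Qed.

(* A zipper [(L, k, R)] is a row of cells [rev L ++ R] with the carried symbol
   [k] sitting between the two parts. *)
Inductive zmove : seq X * X * seq X -> seq X * X * seq X -> Prop :=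
  | ZRight L k h R h' k' : swap k h h' k' -> zmove (L, k, h :: R) (h' :: L, k', R)
  | ZLeft L k h R h' k' : swap k' h' h k -> zmove (h :: L, k, R) (L, k', h' :: R)
  | ZFresh k h R h' k' : fresh h -> swap k' h' h k ->
      zmove ([::], k, R) ([::], k', h' :: R)
  | ZGuess L k k' : guess k k' -> zmove (L, k, [::]) (L, k', [::]).

Inductive zreach : nat -> seq X * X * seq X -> seq X * X * seq X -> Prop :=
  | ZReach0 z : zreach 0 z z
  | ZReachS n z1 z2 z3 : zmove z1 z2 -> zreach n z2 z3 -> zreach n.+1 z1 z3.

Definition zfinal (z : seq X * X * seq X) : Prop :=
  [/\ z.2 = [::], fin z.1.2 & all fin z.1.1].

Lemma zreach_trans m n z1 z2 z3 : zreach m z1 z2 -> zreach n z2 z3 -> zreach (m + n) z1 z3.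
Proof.
by move=> r12 r23; elim: r12 r23 => // {m z1 z2} m z1 z2 z mv _ IH /IH; apply: ZReachS.
Qed.

(** The instruction is chosen before [t], since [t] contains the [Used] cells left by its own unary
    code. *)
Lemma zmove_exec L k R L' k' R' : zmove (L, k, R) (L', k', R') ->
  exists i, forall t, exists2 m, m <= 2 &
  iter m step (at_tape (Back k i) (map (Cell false) L) (marked_right R ++ t)) =
  at_tape (Fetch k' Finish) (map (Cell false) L') (marked_right R' ++ t).
Proof.
move Ez: (L, k, R) => z; move Ez': (L', k', R') => z' mv.
case: mv Ez Ez' => [L0 k0 h R0 h' k1 sw|L0 k0 h R0 h' k1 sw|k0 h R0 h' k1 fr sw|L0 k0 k1 gu].
- move=> [-> -> ->] [-> -> ->]; exists (GoRight h' k1) => t; exists 2 => //.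
  rewrite 2!iterS [iter 0 _ _]/=.
  rewrite (@step_right _ _ _ _ (AtRight k1) (Cell false h')) //; last by rewrite /= sw.
  case: R0 => [|h2 R0] /=.
    by rewrite (@step_stay _ _ _ _ (Fetch k1 Finish) (End true)).
  by rewrite (@step_stay _ _ _ _ (Fetch k1 Finish) (Cell true h2)).
- move=> [-> -> ->] [-> -> ->]; exists (GoLeft h' k1) => t; exists 2 => //.
  rewrite 2!iterS [iter 0 _ _]/=.
  case: R0 => [|h2 R0] /=.
    rewrite (@step_left _ _ _ _ (AtLeft k0 h' k1) (End false)) //.
    by rewrite (@step_stay _ _ _ _ (Fetch k1 Finish) (Cell true h')) //= sw.
  rewrite (@step_left _ _ _ _ (AtLeft k0 h' k1) (Cell false h2)) //.
  by rewrite (@step_stay _ _ _ _ (Fetch k1 Finish) (Cell true h')) //= sw.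
- move=> [-> -> ->] [-> -> ->]; exists (GoLeft h' k1) => t; exists 2 => //.
  (* The fresh symbol is not part of the instruction: on the blank left of the row the machine only
     tests that one exists. *)
  have ex : [exists h0, fresh h0 && swap k1 h' h0 k0] by apply/existsP; exists h; rewrite fr.
  rewrite 2!iterS [iter 0 _ _]/=.
  case: R0 => [|h2 R0] /=.
    rewrite (@step_left _ _ _ _ (AtLeft k0 h' k1) (End false)) //.
    by rewrite (@step_stay _ _ _ _ (Fetch k1 Finish) (Cell true h')) //= ex.
  rewrite (@step_left _ _ _ _ (AtLeft k0 h' k1) (Cell false h2)) //.
  by rewrite (@step_stay _ _ _ _ (Fetch k1 Finish) (Cell true h')) //= ex.
- move=> [-> -> ->] [-> -> ->]; exists (Guess k1) => t; exists 1 => //.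
  rewrite iterS [iter 0 _ _]/=.
  by rewrite (@step_stay _ _ _ _ (Fetch k1 Finish) (End true)) //= gu.
Qed.

Lemma zmove_size z z' : zmove z z' ->
  size z'.1.1 + size z'.2 <= (size z.1.1 + size z.2).+1.
Proof. by case=> /= *; lia. Qed.

Lemma check_complete L t : all fin L ->
  (iter (size L).+1 step (at_left Check (map (Cell false) L) t)).1.1.1 = Accept.
Proof.
elim: L t => [|h L IHL] t.
  by rewrite /at_left /= (@step_stay _ _ _ _ Accept Blank) ?haltingE.
move=> /andP [fh fL]; rewrite iterSr.
rewrite (_ : at_left _ _ _ = at_tape Check (map (Cell false) L) (Cell false h :: t)) //.
by rewrite (@step_left _ _ _ _ Check (Cell false h)) ?haltingE ?IHL //= fh.
Qed.

Lemma check_sound L t : accepting (at_left Check (map (Cell false) L) t) -> all fin L.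
Proof.
elim: L t => // h L IHL t.
rewrite (_ : at_left _ _ _ = at_tape Check (map (Cell false) L) (Cell false h :: t)) //.
have [fh|/negbTE fh] := boolP (fin h); last first.
  by move/not_accepting_stuck; case; rewrite ?haltingE //= fh.
move=> acc; rewrite /= fh; apply: (IHL (Cell false h :: t)); apply: accepting_step acc.
by apply: step_left; rewrite ?haltingE //= fh.
Qed.

(** Each move and the final check cost at most [N.+1] bits. One cycle walks over the row, which
    grows by at most one cell per move, and over the consumed bits; hence the inner factor does not
    grow along the induction. *)
Lemma reach_complete n z z' j : zreach n z z' -> zfinal z' ->
  let N := #|{: instr X}| in
  exists2 bits, size bits <= n.+1 * N.+1 &
  exists2 t, t <= n.+1 * (3 * (size z.1.1 + size z.2 + n + j + n.+1 * N.+1) + 8) &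
  (iter t step (start_cfg z j bits)).1.1.1 = Accept.
Proof.
move=> zr fz' N; elim: zr j fz' => {n z z'} [[[L k] R]|n [[L k] R] [[L' k'] R'] z] .
  move=> j [/= -> fk fL].
  have [m mN mi] := @next_instr_reach X Finish Finish.
  exists (nseq m false ++ [:: true]); first by rewrite size_cat size_nseq /= /N; lia.
  exists ((size L).+1 + (2 * (size (@nil X) + j + m) + 2).+1).
    by rewrite -/N in mN; rewrite /=; nia.
  rewrite iterD [iter _.+1 _ (start_cfg _ _ _)]iterS fetch_cycle mi [marked_right _]/= cat_cons.
  by rewrite (@step_left _ _ _ _ Check (End true)) /= ?fk //; apply: check_complete.
move=> mv _ IH j fz; have [i execP] := zmove_exec mv.
have [m mN mi] := @next_instr_reach X Finish i; rewrite -/N in mN.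
have [bits sb [t tb acc]] := IH (j + m).+1 fz.
have [e e2 ee] := execP (nseq (j + m).+1 Used ++ map (Raw \o inr) bits).
exists (nseq m false ++ true :: bits); first by rewrite size_cat size_nseq /=; nia.
exists (t + (e + (2 * (size R + j + m) + 2))).
  by have /= := zmove_size mv; rewrite /= in tb *; nia.
by rewrite iterD (iterD e) fetch_cycle mi ee.
Qed.

Lemma bits_split (bits : seq bool) :
  bits = nseq (size bits) false \/ exists n bits', bits = nseq n false ++ true :: bits'.
Proof.
elim: bits => [|[] bits IH]; first by left.
  by right; exists 0, bits.
case: IH => [e|[n [bits' ->]]]; first by left; rewrite {1}e.
by right; exists n.+1, bits'.
Qed.

(** An accepting run is decoded one instruction at a time. Each cycle consumes at least the bit
    [true], which justifies induction on the number of bits. *)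
Lemma reach_sound z j bits : accepting (start_cfg z j bits) ->
  exists n z', zreach n z z' /\ zfinal z'.
Proof.
have [b] := ubnP (size bits); elim: b bits z j => // b IHb bits [[L k] R] j sb.
have [->|[n [bits' e]]] := bits_split bits.
  (* Without a [true] bit the head runs onto the blank behind the certificate, where [Fetch]
     rejects. *)
  have [g [s [eR _ pg ps _]]] := marked_rightE R.
  rewrite /start_cfg map_nseq /= => /(accepting_iter (size (marked_right R ++ nseq j Used))).
  rewrite catA fetch_pass; last by rewrite all_cat eR /= pg ps all_nseq orbT.
  move=> /(accepting_iter (size bits)); rewrite -[nseq (size bits) _]cats0 fetch_false.
  by rewrite at_tape_nil => /not_accepting_stuck; case.
rewrite {}e size_cat size_nseq /= in sb *.
move=> /(accepting_iter (2 * (size R + j + n) + 2)); rewrite fetch_cycle.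
set i := iter n _ _; set T := nseq _ _ ++ _.
have next z' : zmove (L, k, R) z' -> accepting (start_cfg z' (j + n).+1 bits') ->
    exists m z'', zreach m (L, k, R) z'' /\ zfinal z''.
  move=> mv /IHb [|m [z'' [zr fz]]]; first by lia.
  by exists m.+1, z''; split=> //; apply: ZReachS mv zr.
case: i => [h' k'|h' k'|k'|].
- case: R next => [|h R] next /=; first by move=> /not_accepting_stuck; case.
  case: (boolP (swap k h h' k')) => [sw|/negbTE sw]; last first.
    by move=> /not_accepting_stuck; case; rewrite //= sw.
  move/(accepting_step (@step_right _ _ _ _ (AtRight k') (Cell false h') _ _)).
  rewrite /= sw => /(_ erefl erefl) acc; apply: next (ZRight _ _ sw) _.
  case: R acc => [|h2 R] /=; apply: accepting_step.
    exact: step_stay.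
  exact: step_stay.
(* Removing the mark leaves the unmarked [R], written here as the tail of a marked row; [h'] is only
   a placeholder. Both shapes of [R] then share one argument. *)
- have left0 : accepting (at_left (AtLeft k h' k') (map (Cell false) L)
      (behead (marked_right (h' :: R)) ++ T)) ->
      exists m z'', zreach m (L, k, R) z'' /\ zfinal z''.
    case: L next => [|h L] next.
      case: (boolP [exists h, fresh h && swap k' h' h k]) => [ex|/negbTE ex]; last first.
        by move=> /not_accepting_stuck; case; rewrite //= ex.
      have [h /andP [fr sw]] := existsP ex => acc; apply: next (ZFresh _ fr sw) _.
      by apply: accepting_step acc; apply: step_stay; rewrite //= ex.
    rewrite (_ : at_left _ _ _ = at_tape (AtLeft k h' k') (map (Cell false) L)
      (Cell false h :: behead (marked_right (h' :: R)) ++ T)) //.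
    case: (boolP (swap k' h' h k)) => [sw|/negbTE sw]; last first.
      by move=> /not_accepting_stuck; case; rewrite //= sw.
    move=> acc; apply: next (ZLeft _ _ sw) _.
    by apply: accepting_step acc; apply: step_stay; rewrite //= sw.
  case: R left0 {next} => [|h R] left0 /= acc; apply: left0.
    by apply: accepting_step acc; apply: step_left.
  by apply: accepting_step acc; apply: step_left.
- case: R next => [|h R] next /=; last by move=> /not_accepting_stuck; case.
  case: (boolP (guess k k')) => [gu|/negbTE gu]; last first.
    by move=> /not_accepting_stuck; case; rewrite //= gu.
  move=> acc; apply: next (ZGuess _ gu) _.
  by apply: accepting_step acc; apply: step_stay; rewrite //= gu.
- case: R next => [|h R] _ /=; last by move=> /not_accepting_stuck; case.
  case: (boolP (fin k)) => [fk|/negbTE fk]; last first.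
    by move=> /not_accepting_stuck; case; rewrite //= fk.
  move=> acc; exists 0, (L, k, [::]); split; first exact: ZReach0.
  split=> //=; apply: (@check_sound _ (End true :: T)); apply: accepting_step acc.
  by apply: step_left; rewrite //= fk.
Qed.

Lemma scan_letters b u l t :
  iter (size u) step (at_tape (Scan b) l (map (Raw \o inl \o Some) u ++ t)) =
  at_tape (Scan b)
    (catrev (map (Cell false \o if b then loadV else loadU) u) l) t.
Proof.
elim: u l => // a u IHu l; rewrite [size _]/= iterSr /=.
rewrite (@step_right _ _ _ _ (Scan b) (Cell false ((if b then loadV else loadU) a))) ?IHu //.
by case: b {IHu}.
Qed.

Definition initial_zip (u v : seq A) : seq X * X * seq X :=
  (rev (map loadU u ++ x1 :: map loadV v), x1, [::]).

Lemma scan_input u v bits :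
  iter (size u + size v + 2) step
    (init_config verifier (map inl (map Some u ++ None :: map Some v) ++ map inr bits)) =
  start_cfg (initial_zip u v) 0 (behead bits).
Proof.
rewrite init_configE !map_cat -catA /= -!map_comp.
rewrite (_ : size u + size v + 2 = (size v + (size u).+1).+1); last by lia.
rewrite iterS iterD iterS scan_letters.
rewrite (@step_right _ _ _ _ (Scan true) (Cell false x1)) // scan_letters.
have <- : map (@Cell A X false) (initial_zip u v).1.1 = catrev (map (Cell false \o loadV) v)
    (Cell false x1 :: catrev (map (Cell false \o loadU) u) [::]).
  by rewrite /= map_rev map_cat /= -!map_comp /rev catrev_catl.
by case: bits => [|b bits] /=; rewrite ?at_tape_nil;
  apply: (@step_stay _ _ _ _ (Fetch x1 Finish) (End true)).
Qed.

Lemma option_split (x : seq (option A)) :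
  (exists u, x = map Some u) \/ exists u y, x = map Some u ++ None :: y.
Proof.
elim: x => [|[a|] x IH]; first by left; exists [::].
  case: IH => [[u ->]|[u [y ->]]]; first by left; exists (a :: u).
  by right; exists (a :: u), y.
by right; exists [::], x.
Qed.

Lemma verifier_sound x bits t : accepts_within verifier (map inl x ++ map inr bits) t ->
  exists u v, x = map Some u ++ None :: map Some v /\
  exists n z, zreach n (initial_zip u v) z /\ zfinal z.
Proof.
move=> acc; have {acc}: accepting (init_config verifier (map inl x ++ map inr bits)) by exists t.
have [[u ->]|[u [y ->]]] := option_split x.
  rewrite init_configE map_cat -!map_comp => /(accepting_iter (size u)).
  rewrite (@scan_letters false); case: bits => [|b bits] /=.
    by rewrite at_tape_nil => /not_accepting_stuck; case.
  by move=> /not_accepting_stuck; case.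
have [[v ->]|[v [y' ->]]] := option_split y.
  move=> /(accepting_iter (size u + size v + 2)); rewrite scan_input => /reach_sound r.
  by exists u, v.
(* A second separator is met in state [Scan true], which rejects it. *)
rewrite init_configE !(map_cat, map_cons) -!map_comp -catA => /(accepting_iter (size u)).
rewrite (@scan_letters false) cat_cons => /(accepting_iter 1).
rewrite [iter 1 _ _]/= (@step_right _ _ _ _ (Scan true) (Cell false x1)) //.
move=> /(accepting_iter (size v)); rewrite -catA (@scan_letters true) cat_cons.
by move=> /not_accepting_stuck; case.
Qed.

Lemma verifier_complete u v n z : zreach n (initial_zip u v) z -> zfinal z ->
  let N := #|{: instr X}| in
  exists2 bits, size bits <= n.+1 * N.+1 + 1 &
  accepts_within verifier
    (map inl (map Some u ++ None :: map Some v) ++ map inr bits)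
    (n.+1 * (3 * (size u + size v + 1 + n + n.+1 * N.+1) + 8) + (size u + size v + 2)).
Proof.
move=> zr fz N; have [bits sb [t tb acc]] := reach_complete 0 zr fz.
rewrite -/N in sb tb.
(* The leading bit is a dummy, to be overwritten by the sentinel. *)
exists (true :: bits); first by rewrite /=; lia.
rewrite /accepts_within iterD scan_input /=; apply: accept_mono acc.
apply: leq_trans tb _; rewrite /= size_rev size_cat /= !size_map.
by apply: leq_mul => //; lia.
Qed.

End Machine.

(** * From explicit run times to a single polynomial exponent *)

Lemma leq_expn_self c z : 2 <= z -> c <= z ^ c.
Proof. by move=> z2; apply/ltnW/ltn_expl. Qed.

Lemma verifier_in_NP (A X : finType) (loadU loadV : A -> X) (x1 : X)
    (swap : X -> X -> X -> X -> bool) (fresh : pred X) (guess : rel X) (fin : pred X)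
    (L : seq A -> seq A -> Prop) (c e : nat) :
  (forall u v n z, zreach swap fresh guess n (initial_zip loadU loadV x1 u v) z ->
     zfinal fin z -> L u v) ->
  (forall u v, L u v -> exists n z,
     [/\ n <= c * (size u + size v).+1 ^ e,
         zreach swap fresh guess n (initial_zip loadU loadV x1 u v) z
       & zfinal fin z]) ->
  in_NP (fun s : seq (option A) =>
    exists u v, s = map Some u ++ None :: map Some v /\ L u v).
Proof.
move=> sound complete; pose N := #|{: instr X}|.
exists ((c + e + N + 2) * 8), (verifier loadU loadV x1 swap fresh guess fin) => s.
split; last first.
  move=> [bits [_ /verifier_sound [u [v [-> [n [z [zr fz]]]]]]]].
  by exists u, v; split=> //; apply: sound zr fz.
move=> [u [v [-> /complete [n [z [nb zr fz]]]]]].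
have [bits sb acc] := verifier_complete zr fz; rewrite -/N in sb acc.
set x := map Some u ++ _; set Z := (size x).+2.
have sx : size x = size u + size v + 1 by rewrite size_cat /= !size_map; lia.
have Z2 : 2 <= Z by [].
(* [y] dominates [n.+1], [N.+1] and [Z], so the run time is at most [19 * y ^ 3]; as [y >= 3], this
   is below [y ^ 8]. *)
pose y := Z ^ (c + e + N + 2).
have Zy a : a <= c + e + N + 2 -> Z ^ a <= y by move=> ?; apply: leq_pexp2l; lia.
have ny : n.+1 <= y.
  have cZ := leq_expn_self c Z2; have eZ : (size u + size v).+1 ^ e <= Z ^ e.
    by case: (posnP e) => [->|e0]; rewrite ?expn0 // leq_exp2r // /Z sx; lia.
  have T0 : 0 < Z ^ c * Z ^ e by rewrite -expnD expn_gt0.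
  have : n.+1 <= Z ^ (c + e + 1).
    rewrite !expnD expn1; have := leq_trans nb (leq_mul cZ eZ).
    by move: (Z ^ c * _) T0 => T T0 nT; nia.
  by move/leq_trans; apply; apply: Zy; lia.
have Ny : N.+1 <= y by apply: leq_trans (leq_expn_self N.+1 Z2) (Zy _ _); lia.
have Zly : Z <= y by rewrite -[Z]expn1; apply: Zy; lia.
have y3 : 3 <= y by lia.
have y8 : 19 * (y * y * y) <= Z ^ ((c + e + N + 2) * 8).
  rewrite expnM -/y (expnD y 5 3); apply: leq_mul; last by rewrite !expnS expn0 muln1 mulnA.
  by apply: (@leq_trans (3 ^ 5)) => //; rewrite leq_exp2r.
have nN : n.+1 * N.+1 <= y * y by apply: leq_mul.
exists bits; split; first by rewrite -/x -/Z; nia.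
rewrite /accepts_within; apply: accept_mono acc.
apply: leq_trans y8.
have : n.+1 * (3 * (size u + size v + 1 + n + n.+1 * N.+1) + 8) <=
   y * (3 * (y + y + y * y) + 8) by apply: leq_mul => //; lia.
by move: (n.+1 * _) => w; nia.
Qed.

(** * Rewriting the two tracks *)

(** The relations used below become finite tables over a finite alphabet, which the machine can
    contain however they were decided. *)
Definition decb (P : Prop) : bool :=
  if excluded_middle_informative P then true else false.

Lemma decbP P : reflect P (decb P).
Proof. by rewrite /decb; case: excluded_middle_informative => ?; constructor. Qed.

(* [sweep k F F' k'] says that the carried symbol [k] can be pushed through the
   row [F] from left to right, leaving [F'] and coming out as [k']. *)
Inductive sweep (X : Type) (sw : X -> X -> X -> X -> Prop) :
    X -> seq X -> seq X -> X -> Prop :=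
  | SweepNil k : sweep sw k [::] [::] k
  | SweepCons k h h' k1 F F' k' :
      sw k h h' k1 -> sweep sw k1 F F' k' -> sweep sw k (h :: F) (h' :: F') k'.

Lemma sweep_size (X : Type) (sw : X -> X -> X -> X -> Prop) k F F' k' :
  sweep sw k F F' k' -> size F' = size F.
Proof. by elim=> //= {k F F' k'} k h h' k1 F F' k' _ _ ->. Qed.

(** * Sweeps of the carried symbol *)

Section Zipper.
Variables (X : finType) (swap : X -> X -> X -> X -> bool) (fresh : pred X) (guess : rel X).
Local Notation reach := (zreach swap fresh guess).

Lemma sweep_right k F F' k' L R : sweep swap k F F' k' ->
  reach (size F) (L, k, F ++ R) (rev F' ++ L, k', R).
Proof.
move=> sw; elim: sw L => {k F F' k'} [k|k h h' k1 F F' k' sw _ IH] L; first exact: ZReach0.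
apply: (@ZReachS _ _ _ _ _ _ (h' :: L, k1, F ++ R)); first exact: ZRight.
by rewrite rev_cons cat_rcons; apply: IH.
Qed.

Lemma zreach_rcons n z1 z2 z3 : reach n z1 z2 -> zmove swap fresh guess z2 z3 ->
  reach n.+1 z1 z3.
Proof.
move=> r mv; rewrite -addn1; apply: zreach_trans r _.
by apply: ZReachS mv _; apply: ZReach0.
Qed.

(** [ZLeft] uses the same [swap] relation read backwards, so every sweep can be undone. *)
Lemma sweep_left k F F' k' L R : sweep swap k F F' k' ->
  reach (size F) (rev F' ++ L, k', R) (L, k, F ++ R).
Proof.
move=> sw; elim: sw L => {k F F' k'} [k|k h h' k1 F F' k' sw _ IH] L; first exact: ZReach0.
rewrite rev_cons cat_rcons; apply: zreach_rcons (IH (h' :: L)) _.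
exact: ZLeft.
Qed.

(** The way right turns [F] into [H]; the way back undoes the sweep that would turn [G] into [H]. *)
Lemma sweep_round_trip k F H G k' L R :
  sweep swap k F H k' -> sweep swap k G H k' ->
  reach (size F + size G) (L, k, F ++ R) (L, k, G ++ R).
Proof.
by move=> swF swG; apply: zreach_trans (sweep_right L R swF) (sweep_left L R swG).
Qed.

End Zipper.

Local Arguments evalw : simpl never.

Section Tracks.
Variables (M : Type) (mul : M -> M -> M) (one : M).
Hypothesis monoid_mul : is_monoid mul one.
Local Notation "x ** y" := (mul x y) (at level 40, left associativity).

Let mulA x y z : x ** (y ** z) = x ** y ** z.
Proof. by case: monoid_mul => ->. Qed.
Let mul1 x : one ** x = x. Proof. by case: monoid_mul => _ [->]. Qed.
Let mulx1 x : x ** one = x. Proof. by case: monoid_mul => _ [_ ->]. Qed.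

(** * Values of the two tracks and their rewriting *)

Section Alphabet.
Variables (C : finType) (val : C -> M) (c1 : C) (isL : bool).
Hypothesis val_c1 : val c1 = one.
Local Notation pv := (evalw mul one val).

Definition swap1 (k h h' k' : C) : Prop := val k ** val h = val h' ** val k'.
Definition swap2 (k h h' k' : C * C) : bool :=
  decb (swap1 k.1 h.1 h'.1 k'.1 /\ swap1 k.2 h.2 h'.2 k'.2).
(* In the L-order case the left factor is guessed on fresh cells at the left end,
   in the R-order case the right factor is guessed through the carried symbol at
   the right end. *)
Definition fresh2 (h : C * C) : bool :=
  decb (val h.1 = one /\ (isL \/ val h.2 = one)).
Definition guess2 (k k' : C * C) : bool :=
  decb [/\ ~~ isL, k.1 = k'.1 & exists m, val k'.2 = val k.2 ** m].
Definition diag (x : C * C) : bool := x.1 == x.2.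

Local Notation reach := (zreach swap2 fresh2 guess2).

Definition row (z : seq (C * C) * (C * C) * seq (C * C)) := rev z.1.1 ++ z.1.2 :: z.2.
Definition top z := pv (map fst (row z)).
Definition bot z := pv (map snd (row z)).

Definition factor_of (x y : M) : Prop :=
  exists m, y = if isL then m ** x else x ** m.

Lemma factor_of_refl x : factor_of x x.
Proof. by exists one; case: isL; rewrite ?mul1 ?mulx1. Qed.

Lemma factor_of_trans x y z : factor_of x y -> factor_of y z -> factor_of x z.
Proof.
rewrite /factor_of => -[m ->] [m' ->]; case: isL; first by exists (m' ** m); rewrite mulA.
by exists (m ** m'); rewrite mulA.
Qed.

(** The soundness invariant. A swap is a relation in the monoid; a fresh cell is the leftmost letter
    and a guess changes the rightmost one, so the bottom value gains a factor on the permitted side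
    only. *)
Lemma zmove_value z z' : zmove swap2 fresh2 guess2 z z' ->
  top z' = top z /\ factor_of (bot z) (bot z').
Proof.
rewrite /top /bot /row.
case=> [L k h R h' k' /decbP [s1 s2]|L k h R h' k' /decbP [s1 s2]|
        k h R h' k' /decbP [f1 f2] /decbP [s1 s2]|L k k' /decbP [nL e1 [m e2]]] /=.
- rewrite rev_cons cat_rcons !map_cat /= !(evalw_cat monoid_mul) !(evalw_cons monoid_mul).
  by rewrite !(mulA (val _)) s1 s2; split=> //; apply: factor_of_refl.
- rewrite rev_cons cat_rcons !map_cat /= !(evalw_cat monoid_mul) !(evalw_cons monoid_mul).
  by rewrite !(mulA (val _)) s1 s2; split=> //; apply: factor_of_refl.
- rewrite !(evalw_cons monoid_mul) !(mulA (val _)) s1 s2 f1 mul1; split=> //.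
  case: f2 => [iL|->]; last by rewrite mul1; apply: factor_of_refl.
  by exists (val h.2); rewrite iL mulA.
- rewrite !map_cat /= !(evalw_cat monoid_mul) !(evalw1 monoid_mul) e1; split=> //.
  by exists m; rewrite (negbTE nL) e2 mulA.
Qed.

Lemma zreach_value n z z' : reach n z z' -> top z' = top z /\ factor_of (bot z) (bot z').
Proof.
elim=> {n z z'} [z|n z1 z2 z3 /zmove_value [t12 b12] _ [t23 b23]].
  by split=> //; apply: factor_of_refl.
by split; [rewrite t23 | apply: factor_of_trans b12 b23].
Qed.

Lemma zfinal_value z : zfinal diag z -> top z = bot z.
Proof.
case: z => [[L k] R] [/= -> /eqP ek eL]; rewrite /top /bot /row /= !map_cat /= ek.
congr (pv (_ ++ _)); apply/eq_in_map => x; rewrite mem_rev => /(allP eL).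
by move/eqP.
Qed.

Lemma pv_nseq n : pv (nseq n c1) = one.
Proof. by elim: n => // n IHn; rewrite [nseq _ _]/= (evalw_cons monoid_mul) IHn val_c1 mul1. Qed.

Section Loading.
Variables (A : finType) (gen : A -> M) (inA : A -> C).
Hypothesis val_inA : forall a, val (inA a) = gen a.

Definition load_top (a : A) : C * C := (inA a, c1).
Definition load_bot (a : A) : C * C := (c1, inA a).

(** The extra [c1] on each track fills the separator cell. *)
Definition top_word (u v : seq A) := map inA u ++ nseq (size v).+1 c1.
Definition bot_word (u v : seq A) := nseq (size u).+1 c1 ++ map inA v.

Lemma pv_map_inA u : pv (map inA u) = evalw mul one gen u.
Proof. by elim: u => // a u IHu; rewrite /= !(evalw_cons monoid_mul) IHu val_inA. Qed.

Lemma pv_top_word u v : pv (top_word u v) = evalw mul one gen u.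
Proof. by rewrite /top_word (evalw_cat monoid_mul) pv_nseq mulx1 pv_map_inA. Qed.

Lemma pv_bot_word u v : pv (bot_word u v) = evalw mul one gen v.
Proof. by rewrite /bot_word (evalw_cat monoid_mul) pv_nseq mul1 pv_map_inA. Qed.

Lemma initial_zipE u v : initial_zip load_top load_bot (c1, c1) u v =
  (rev (zip (top_word u v) (bot_word u v)), (c1, c1), [::]).
Proof.
rewrite /initial_zip; congr (rev _, _, _).
rewrite /top_word /bot_word; elim: u => [|a u IHu] /=; last by rewrite IHu.
by congr cons; elim: v => //= a v ->.
Qed.

Lemma initial_top u v : top (initial_zip load_top load_bot (c1, c1) u v) =
  evalw mul one gen u.
Proof.
rewrite initial_zipE; set s := zip _ _.
have es : map fst s = top_word u v.
  by apply: unzip1_zip; rewrite !size_cat !size_map !size_nseq; lia.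
rewrite /top /row [LHS]/= revK map_cat es (evalw_cat monoid_mul) (evalw1 monoid_mul).
by rewrite val_c1 mulx1 pv_top_word.
Qed.

Lemma initial_bot u v : bot (initial_zip load_top load_bot (c1, c1) u v) =
  evalw mul one gen v.
Proof.
rewrite initial_zipE; set s := zip _ _.
have es : map snd s = bot_word u v.
  by apply: unzip2_zip; rewrite !size_cat !size_map !size_nseq; lia.
rewrite /bot /row [LHS]/= revK map_cat es (evalw_cat monoid_mul) (evalw1 monoid_mul).
by rewrite val_c1 mulx1 pv_bot_word.
Qed.

Lemma zreach_sound u v n z :
  reach n (initial_zip load_top load_bot (c1, c1) u v) z -> zfinal diag z ->
  factor_of (evalw mul one gen v) (evalw mul one gen u).
Proof.
move=> /zreach_value [t b] /zfinal_value e.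
by rewrite -(initial_top u v) -(initial_bot u v) -t e.
Qed.

End Loading.

(** The other track carries [c1], which passes every symbol of [T] unchanged. *)
Lemma sweep_top k F F' k' T : sweep swap1 k F F' k' -> size T = size F ->
  sweep swap2 (k, c1) (zip F T) (zip F' T) (k', c1).
Proof.
move=> sw; elim: sw T => {k F F' k'} [k|k h h' k1 F F' k' sw _ IH] [|t T] //=.
  by move=> _; apply: SweepNil.
move=> [sT]; apply: SweepCons (IH _ sT); apply/decbP; split=> //=.
by rewrite /swap1 val_c1 mul1 mulx1.
Qed.

Lemma sweep_bot k F F' k' T : sweep swap1 k F F' k' -> size T = size F ->
  sweep swap2 (c1, k) (zip T F) (zip T F') (c1, k').
Proof.
move=> sw; elim: sw T => {k F F' k'} [k|k h h' k1 F F' k' sw _ IH] [|t T] //=.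
  by move=> _; apply: SweepNil.
move=> [sT]; apply: SweepCons (IH _ sT); apply/decbP; split=> //=.
by rewrite /swap1 val_c1 mul1 mulx1.
Qed.

Lemma sweep_id F : sweep swap2 (c1, c1) F F (c1, c1).
Proof.
elim: F => [|h F IH]; first exact: SweepNil.
by apply: SweepCons IH; apply/decbP; rewrite /swap1 /= val_c1 !mul1 !mulx1.
Qed.

(** Every swap is the trivial relation exchanging carried symbol and cell, so a symbol entering at
    one end shifts the row by one place. *)
Lemma sweep_shift V b : exists k V', k :: V' = rcons V b /\ sweep swap1 k V' V b.
Proof.
elim: V => [|v V [k [V' [e sw]]]]; first by exists b, [::]; split=> //; apply: SweepNil.
by exists v, (k :: V'); split; [rewrite /= e | apply: SweepCons sw].
Qed.

(* One round trip of the head over a prefix of the row. *)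
Inductive normalizes : nat -> seq C -> seq C -> Prop :=
  | Norm0 W : normalizes 0 W W
  | NormS n F H G R W : sweep swap1 c1 F H c1 -> sweep swap1 c1 G H c1 ->
      normalizes n W (F ++ R) -> normalizes n.+1 W (G ++ R).

Lemma normalizes_size n W G : normalizes n W G -> size G = size W.
Proof.
elim=> // {n W G} n F H G R W swF swG _ <-.
by rewrite !size_cat -(sweep_size swF) (sweep_size swG).
Qed.

Lemma normalizes_cat n W G R : normalizes n W G -> normalizes n (W ++ R) (G ++ R).
Proof.
elim=> {n W G} [W|n F H G R' W swF swG _ IH]; first exact: Norm0.
by rewrite -catA; apply: NormS swF swG _; rewrite catA.
Qed.

Lemma normalizes_top n W G T : normalizes n W G -> size T = size W ->
  exists2 m, m <= 2 * n * size W &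
    reach m ([::], (c1, c1), zip W T) ([::], (c1, c1), zip G T).
Proof.
elim=> {n W G} [W|n F H G R W swF swG nW IH] sT; first by exists 0 => //; apply: ZReach0.
have [m mb rm] := IH sT; have sFR := normalizes_size nW.
have sF := sweep_size swF; have sG := sweep_size swG; rewrite size_cat in sFR.
exists (m + (size F + size F)); first by nia.
apply: zreach_trans rm _.
rewrite -(cat_take_drop (size F) T) !zip_cat; last 2 first.
- by rewrite size_takel //; lia.
- by rewrite size_takel //; lia.
have sTF : size (take (size F) T) = size F by rewrite size_takel //; lia.
have sTG : size (take (size F) T) = size G by rewrite sTF -sF.
have := sweep_round_trip fresh2 guess2 [::] (zip R (drop (size F) T))
  (sweep_top swF sTF) (sweep_top swG sTG).
by rewrite !size_zip sTF -sG sF !minnn.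
Qed.

Lemma normalizes_bot n W G T : normalizes n W G -> size T = size W ->
  exists2 m, m <= 2 * n * size W &
    reach m ([::], (c1, c1), zip T W) ([::], (c1, c1), zip T G).
Proof.
elim=> {n W G} [W|n F H G R W swF swG nW IH] sT; first by exists 0 => //; apply: ZReach0.
have [m mb rm] := IH sT; have sFR := normalizes_size nW.
have sF := sweep_size swF; have sG := sweep_size swG; rewrite size_cat in sFR.
exists (m + (size F + size F)); first by nia.
apply: zreach_trans rm _.
rewrite -(cat_take_drop (size F) T) !zip_cat; last 2 first.
- by rewrite size_takel //; lia.
- by rewrite size_takel //; lia.
have sTF : size (take (size F) T) = size F by rewrite size_takel //; lia.
have sTG : size (take (size F) T) = size G by rewrite sTF -sF.
have := sweep_round_trip fresh2 guess2 [::] (zip (drop (size F) T) R)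
  (sweep_bot swF sTF) (sweep_bot swG sTG).
by rewrite !size_zip sTF -sG sF !minnn.
Qed.

Lemma fresh_left w T V : isL ->
  reach (size w) ([::], (c1, c1), zip T V)
    ([::], (c1, c1), zip (nseq (size w) c1 ++ T) (w ++ V)).
Proof.
move=> iL; elim: w => [|b w IHw]; first exact: ZReach0.
apply: zreach_rcons IHw _; apply: (@ZFresh _ _ _ _ _ (c1, b)); apply/decbP.
  by rewrite /= val_c1; split=> //; left.
by rewrite /swap1 /= val_c1 !(mul1, mulx1).
Qed.

(** The letter [b] is guessed at the right end, shifted into the bottom track on the way left, and
    the displaced symbol is stored in a fresh leftmost cell. Guess, way left, fresh cell and way
    right give the count. *)
Lemma guess_right1 b T V : ~~ isL -> size T = size V ->
  reach (2 * size T + 3) (rev (zip T V), (c1, c1), [::])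
    (rev (zip (c1 :: T) (rcons V b)), (c1, c1), [::]).
Proof.
move=> nL sTV; have [k [V' [e sw]]] := sweep_shift V b; have sV := sweep_size sw.
have sz : size (zip T V') = size T by rewrite size_zip sTV sV minnn.
rewrite (_ : 2 * _ + 3 = (size (zip T V') + (1 + (size T).+1)).+1); last by lia.
apply: (@ZReachS _ _ _ _ _ _ (rev (zip T V), (c1, b), [::])).
  by apply: ZGuess; apply/decbP; split=> //; exists (val b); rewrite /= val_c1 mul1.
apply: zreach_trans.
  have sw2 := @sweep_bot _ _ _ _ T sw; rewrite -[rev _]cats0.
  by apply: sweep_left (sw2 _); rewrite sTV sV.
rewrite cats0; apply: (@ZReachS _ _ _ _ _ _ ([::], (c1, c1), (c1, k) :: zip T V')).
  apply: (@ZFresh _ _ _ _ _ (c1, c1)); apply/decbP; first by rewrite /= val_c1; split=> //; right.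
  by rewrite /swap1 /= val_c1 !(mul1, mulx1).
rewrite -e -[X in (rev X, _, _)]/((c1, k) :: zip T V') -sz.
have := @sweep_right _ swap2 fresh2 guess2 _ _ _ _ [::] [::] (sweep_id ((c1, k) :: zip T V')).
by rewrite !cats0.
Qed.

Lemma guess_right w T V : ~~ isL -> size T = size V ->
  exists2 m, m <= size w * (2 * (size T + size w) + 3) &
  reach m (rev (zip T V), (c1, c1), [::])
    (rev (zip (nseq (size w) c1 ++ T) (V ++ w)), (c1, c1), [::]).
Proof.
move=> nL; elim: w T V => [|b w IHw] T V sTV.
  by exists 0 => //=; rewrite cats0; apply: ZReach0.
have [|m mb rm] := IHw (c1 :: T) (rcons V b); first by rewrite /= size_rcons sTV.
exists (2 * size T + 3 + m); first by rewrite /= in mb *; nia.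
apply: zreach_trans (guess_right1 b nL sTV) _.
rewrite cat_rcons (_ : nseq _ _ ++ c1 :: T = nseq (size (b :: w)) c1 ++ T) // in rm.
by rewrite /=; elim: (size w) => //= n ->.
Qed.

Lemma normalizes_final n T V G : size T = size V ->
  normalizes n T G -> normalizes n V G ->
  exists m z, [/\ m <= 4 * n * size T + size T,
    reach m ([::], (c1, c1), zip T V) z & zfinal diag z].
Proof.
move=> sTV nT nV; have sG := normalizes_size nT.
have [m1 b1 r1] := normalizes_top nT (esym sTV).
have [m2 b2 r2] := normalizes_bot nV (etrans sG sTV).
exists (m1 + (m2 + size (zip G G))), (rev (zip G G), (c1, c1), [::]); split.
- by rewrite size_zip minnn sG; nia.
- apply: zreach_trans r1 (zreach_trans r2 _).
  have := @sweep_right _ swap2 fresh2 guess2 _ _ _ _ [::] [::] (sweep_id (zip G G)).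
  by rewrite !cats0.
- split; rewrite //= /diag ?eqxx // all_rev.
  by elim: (G) => //= c G' ->; rewrite eqxx.
Qed.

(** The guessed factor is inserted, the head brought to the left end, and both tracks normalized to
    the same [G]. The padding of the top track is on the left in both cases, as identities may stand
    anywhere. *)
Lemma zreach_complete w T V G n :
  size T = size V -> let T' := nseq (size w) c1 ++ T in
  let V' := if isL then w ++ V else V ++ w in
  normalizes n T' G -> normalizes n V' G ->
  let P := size w + size T in
  exists m z, [/\ m <= 4 * n * P + 2 * P * P + 6 * P,
    reach m (rev (zip T V), (c1, c1), [::]) z & zfinal diag z].
Proof.
move=> sTV T' V' nT nV P.
have sT' : size T' = P by rewrite size_cat size_nseq.
have sV' : size T' = size V'.
  by rewrite sT' /V' /P sTV; case: isL; rewrite size_cat //; lia.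
have [m [z [mb rz fz]]] := normalizes_final sV' nT nV; rewrite sT' in mb.
have back T0 V0 : size T0 = size V0 ->
    reach (size T0) (rev (zip T0 V0), (c1, c1), [::]) ([::], (c1, c1), zip T0 V0).
  move=> s0; have := @sweep_left _ swap2 fresh2 guess2 _ _ _ _ [::] [::] (sweep_id (zip T0 V0)).
  by rewrite !cats0 size_zip -s0 minnn.
have [iL|nL] := boolP isL.
  exists (size T + (size w + m)), z; split=> //; first by rewrite /P in mb *; nia.
  apply: zreach_trans (back _ _ sTV) _; apply: zreach_trans (fresh_left w T V iL) _.
  by move: rz; rewrite /V' iL.
have [m' mb' rm'] := guess_right w nL sTV.
exists (m' + (P + m)), z; split=> //; first by rewrite /P in mb *; nia.
apply: zreach_trans rm' _; rewrite /V' (negbTE nL) in rz sV'.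
by rewrite -sT'; apply: zreach_trans (back _ _ sV') rz.
Qed.

End Alphabet.

Hypothesis cancel_mul : left_cancellative mul.

(** * Normalizing a row to a geodesic *)

Section Normalization.
Variables (B : finType) (gen : B -> M) (s D K : nat).
Local Notation ev := (evalw mul one gen).
Local Notation dle := (dist_le mul one gen).
Local Notation sh := (shortest mul one gen).
Local Notation C := (K.-bseq B).
Let val (c : C) := ev c.
Local Notation pv := (evalw mul one val).
Local Notation c1 := ([bseq] : C).

Lemma dleP x y : dle x y K <-> exists c : C, x ** val c = y.
Proof.
split=> [[w [sw e]]|[c e]]; first by exists (Bseq sw).
by exists c; split=> //; apply: size_bseq.
Qed.

Lemma word_of_path (f : nat -> M) n : f 0 = one ->
  (forall j, j < n -> dle (f j) (f j.+1) K) ->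
  exists2 H : seq C, size H = n & forall j, j <= n -> pv (take j H) = f j.
Proof.
move=> f0; elim: n => [|n IHn] fs; first by exists [::] => // -[].
have [|H sH pH] := IHn; first by move=> j jn; apply: fs; lia.
have [c fc] := (dleP _ _).1 (fs n (ltnSn n)).
exists (rcons H c); first by rewrite size_rcons sH.
move=> j; rewrite leq_eqVlt => /predU1P [->|jn].
  by rewrite take_oversize ?size_rcons ?sH // evalw_rcons // -{1}[H]take_size sH pH.
by rewrite -cats1 takel_cat ?pH // sH.
Qed.

(** Each rung of the ladder between the two rows is a carried symbol, and left cancellation of
    [val h] moves the ladder one cell on. The equation [e] prescribes the last rung. *)
Lemma sweep_ladder k k' f h F H : size F = size H ->
  (forall i, i <= (size F).+1 ->
     dle (pv (take i (h :: H))) (val k ** pv (take i (f :: F))) K) ->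
  pv (h :: H) ** val k' = val k ** pv (f :: F) ->
  sweep (swap1 val) k (f :: F) (h :: H) k'.
Proof.
elim: F k f h H => [|f2 F IHF] k f h [|h2 H] // sFH close e.
  apply: SweepCons (SweepNil _ _).
  by move: e; rewrite !(evalw1 monoid_mul).
have [c hc] := (dleP _ _).1 (close 1 isT).
rewrite /= !(evalw1 monoid_mul) in hc.
apply: (@SweepCons _ _ _ _ _ c); first by [].
apply: IHF => [|i ile|].
- by case: sFH.
- apply/dleP; have /dleP [c' hc'] := close i.+1 ile; exists c'.
  apply: (@cancel_mul (val h)); rewrite !mulA hc.
  by move: hc'; rewrite /= !(evalw_cons monoid_mul val) !mulA.
- apply: (@cancel_mul (val h)); rewrite !mulA hc.
  by move: e; rewrite !(evalw_cons monoid_mul val) !mulA.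
Qed.

Lemma val_c1 : val c1 = one. Proof. by []. Qed.

Lemma sweep_of_close F H : 0 < size F -> size F = size H -> pv F = pv H ->
  (forall i, i <= size F -> dle (pv (take i H)) (pv (take i F)) K) ->
  sweep (swap1 val) c1 F H c1.
Proof.
case: F H => // f F [|h H] // _ [sFH] e close.
by apply: sweep_ladder => // [i ile|]; rewrite val_c1 mul1 ?mulx1 //; apply: close.
Qed.

(** The canonical row advances along [r] by [s] letters per cell; [take] saturates, so surplus cells
    stay at the end of [r]. *)
Definition follows (r : seq B) (G : seq C) :=
  forall j, j <= size G -> pv (take j G) = ev (take (s * j) r).

Hypothesis fellow : forall p q r, sh p -> sh q -> sh r -> size q <= s ->
  ev r = ev p ** ev q -> size p <= size r + D /\
  forall i, i <= size p -> dle (ev (take (i - D) r)) (ev (take i p)) K.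
Hypothesis sDK : s + D <= K.

Lemma follows_exists r n : exists2 G, size G = n & follows r G.
Proof.
have [||G sG pG] := @word_of_path (fun j => ev (take (s * j) r)) n.
- by rewrite muln0 take0.
- move=> j _; apply: dist_le_mono (dist_le_take monoid_mul gen r _); nia.
by exists G => // j; rewrite sG => /pG.
Qed.

Lemma shortest_pv_size W p : all (fun c : C => size c <= s) W -> sh p ->
  ev p = pv W -> size p <= s * size W.
Proof.
move=> sW shp ep; have [w] : exists2 w, ev w = pv W & size w <= s * size W.
  elim: W sW {ep} => [|c W IHW] /=; first by exists [::].
  move=> /andP [sc /IHW [w ew sw]]; exists (c ++ w); last by rewrite size_cat; nia.
  by rewrite (evalw_cat monoid_mul) ew (evalw_cons monoid_mul).
by move=> ew sw; apply: leq_trans sw; apply: shp; rewrite ew.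
Qed.

(** Induction from the right end: the prefix is rewritten to [Gp] along a geodesic [p], and one
    further round trip absorbs the last letter [a], whose geodesic [q] is the short side of the
    triangle. *)
Lemma normalizes_geodesic W r G : all (fun c : C => size c <= s) W ->
  sh r -> ev r = pv W -> size G = size W -> follows r G ->
  normalizes val c1 (size W) W G.
Proof.
elim/last_ind: W r G => [|W a IHW] r G.
  by move=> _ _ _ /size0nil -> _; apply: Norm0.
rewrite all_rcons => /andP [sa sW] shr er sG fG.
have [w ew] : exists w, ev w = pv W.
  elim: (W) => [|c W' [w ew]]; first by exists [::].
  by exists (c ++ w); rewrite (evalw_cat monoid_mul) ew (evalw_cons monoid_mul).
have [p [shp ep _]] := shortest_exists mul one gen w; rewrite ew in ep.
have [q [shq eq sq]] := shortest_exists mul one gen a.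
have [Gp sGp fGp] := follows_exists p (size W).
have IH := IHW _ _ sW shp ep sGp fGp.
rewrite evalw_rcons // in er; rewrite size_rcons in sG *.
have erpq : ev r = ev p ** ev q by rewrite er ep eq.
have [pr close] := fellow shp shq shr (leq_trans sq sa) erpq.
have sp := shortest_pv_size sW shp ep.
have rp : size r <= size p + s.
  by apply: leq_trans (shr (p ++ q) _) _; rewrite ?(evalw_cat monoid_mul) // size_cat; lia.
set i := size W in sp sG sGp *.
(* [H] lags behind both geodesics by [D], so it is close to each of them. *)
pose f j := if j <= i then ev (take (minn (s * j) (size p) - D) r) else ev r.
have [||H sH pH] := @word_of_path f i.+1.
- by rewrite /f muln0 min0n sub0n take0.
- move=> j ji; rewrite /f (_ : j <= i) //; case: ltnP => [ji'|ij].
    by apply: dist_le_mono (dist_le_take monoid_mul gen r _); nia.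
  (* The last cell of [H] leads from index [size p - D] to the end of [r]; by [rp] this is at most
     [s + D] letters. *)
  rewrite (_ : j = i); last by lia.
  rewrite (minn_idPr sp) -[X in dle _ (ev X)](take_size r).
  by apply: dist_le_mono (dist_le_take monoid_mul gen r _); lia.
have fGi : pv Gp = ev p.
  by rewrite -[Gp]take_size fGp // sGp take_oversize.
have eH : pv H = ev r.
  by rewrite -[H]take_size sH pH // /f ltnn.
have eG : pv G = ev r.
  rewrite -[G]take_size fG // sG take_oversize //; nia.
rewrite -[G]cats0; apply: (NormS (F := rcons Gp a) (H := H)).
- apply: sweep_of_close; rewrite ?size_rcons ?sGp ?sH //.
    by rewrite evalw_rcons // fGi eH er ep.
  move=> j ji; rewrite pH // /f; case: ltnP => [ij|ij].
    rewrite take_oversize ?size_rcons ?sGp // evalw_rcons // fGi ep -er.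
    exact: dist_le_refl.
  rewrite -cats1 takel_cat ?sGp // fGp ?sGp //.
  have := close _ (geq_minr (s * j) (size p)).
  by rewrite [take (minn _ _) p]take_min take_size.
- apply: sweep_of_close; rewrite ?sG ?sH // ?eG ?eH //.
  move=> j ji; rewrite pH // fG ?sG // /f; case: ltnP => [ij|ij].
    by rewrite take_oversize; [apply: dist_le_refl | nia].
  (* [pr] keeps [H] behind [G], and [rp] bounds its lag by [s + D]. *)
  rewrite (_ : take (s * j) r = take (minn (s * j) (size r)) r); last by rewrite take_min take_size.
  by apply: dist_le_mono (dist_le_take monoid_mul gen r _); lia.
- by rewrite cats0 -!cats1; apply: normalizes_cat.
Qed.

End Normalization.
End Tracks.

(** * The two orders *)

Section Orders.
Variables (M : Type) (mul : M -> M -> M) (one : M).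
Hypothesis monoid_mul : is_monoid mul one.
Hypothesis cancel_mul : left_cancellative mul.
Hypothesis indeg : bounded_indegree mul one.
Hypothesis hyp : strongly_hyperbolic mul one.
Variables (A : finType) (genA : A -> M).
Local Notation "x ** y" := (mul x y) (at level 40, left associativity).

Lemma factor_in_NP (isL : bool) :
  rel_in_NP mul one genA (fun x y => factor_of mul isL y x).
Proof.
case: (monoid_mul) => mulA [mul1 mulx1].
case: hyp => B [gen [delta [gens hypB]]].
have [s0 hs0] := generates_bounded genA gens.
(* The successor makes room for single letters of [B], which spell the guessed factor. *)
pose s := s0.+1.
have [D [Kf fellow]] := fellow_travel monoid_mul cancel_mul gens hypB indeg s.
have [S hS] := factor_length_bound monoid_mul cancel_mul gens hypB indeg.
pose K := s + D + Kf; pose C := K.-bseq B.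
pose ev := evalw mul one gen; pose val (c : C) := ev c; pose c1 : C := [bseq].
have [inA /all_and2 [inA_s inA_val]] : exists inA : A -> C,
    forall a, size (inA a) <= s /\ val (inA a) = genA a.
  apply: (choice (fun a (c : C) => size c <= s /\ val c = genA a)) => a.
  have [w [sw ew]] := hs0 a; have wK : size w <= K by rewrite /K /s; lia.
  by exists (Bseq wK); rewrite /= /s; split=> //; lia.
have letter_s (b : B) : size [:: b] <= K by rewrite /K /s /=; lia.
pose letter (b : B) : C := Bseq (letter_s b).
(* The padded row has at most [S * (s * n).+1 + n.+1] cells, hence at most [Q * n.+1]. *)
pose Q := S * s + 1.
apply: (verifier_in_NP (loadU := load_top c1 inA) (loadV := load_bot c1 inA)
  (x1 := (c1, c1)) (swap := swap2 mul val) (fresh := fresh2 one val isL)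
  (guess := guess2 mul val isL) (fin := @diag C) (c := 20 * Q * Q) (e := 2)).
  by move=> u v n z; apply: zreach_sound.
move=> u v [m xm].
set x := evalw mul one genA u in xm; set y := evalw mul one genA v in xm.
set n := size u + size v.
have dleA w : size w <= n -> dist_le mul one gen one (evalw mul one genA w) (s * n).
  move=> wn; have [w' [sw' ew']] := evalw_translate monoid_mul hs0 w.
  by exists w'; rewrite mul1; split=> //; rewrite /s; nia.
have xym : x = y ** m \/ x = m ** y by move: xm; case: isL; [right | left].
have [w [sw ew]] := hS _ _ _ _ xym (dleA u (leq_addr _ _)) (dleA v (leq_addl _ _)).
rewrite mul1 in ew.
have [w0 ew0] := gens x.
have [r [shr er _]] := shortest_exists mul one gen w0; rewrite ew0 in er.
set wC := map letter w.
pose T := top_word c1 inA u v; pose V := bot_word c1 inA u v.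
have sT : size T = n.+1 by rewrite size_cat size_map size_nseq /n; lia.
have sV : size V = n.+1 by rewrite size_cat size_map size_nseq /n; lia.
have sDK : s + D <= K by rewrite /K; lia.
(* Once the factor is inserted, both tracks have value [x], so one row along one geodesic for [x]
   serves both. *)
have [G sG fG] := follows_exists monoid_mul gen sDK r (size wC + n.+1).
have fellowK p q r' : shortest mul one gen p -> shortest mul one gen q ->
    shortest mul one gen r' -> size q <= s -> ev r' = ev p ** ev q ->
    size p <= size r' + D /\
    forall i, i <= size p -> dist_le mul one gen (ev (take (i - D) r')) (ev (take i p)) K.
  move=> shp shq shr' qs e; have [h1 h2] := fellow _ _ _ shp shq shr' qs e.
  by split=> // i /h2; apply: dist_le_mono; rewrite /K; lia.
have normal W : all (fun c : C => size c <= s) W -> evalw mul one val W = x ->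
    size W = size wC + n.+1 -> normalizes mul val c1 (size wC + n.+1) W G.
  move=> sW eW zW; rewrite -zW.
  apply: (normalizes_geodesic monoid_mul cancel_mul fellowK sDK sW shr _ _ fG).
    by rewrite eW.
  by rewrite sG.
have short_nseq k : all (fun c : C => size c <= s) (nseq k c1) by rewrite all_nseq orbT.
have short_map w' : all (fun c : C => size c <= s) (map inA w').
  by rewrite all_map; apply/allP => a _ /=.
have short_wC : all (fun c : C => size c <= s) wC.
  by rewrite all_map; apply/allP => b _ /=; rewrite /s.
have val_wC : evalw mul one val wC = m.
  rewrite -ew /wC; elim: (w) => // b w' IH.
  by rewrite /= !(evalw_cons monoid_mul) IH /val /ev /= (evalw1 monoid_mul).
have val1 : val c1 = one by [].
have [|||k [z [kb rz fz]]] := @zreach_complete _ mul one monoid_mul C val c1 isL val1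
  wC T V G (size wC + n.+1).
- by rewrite sT.
- apply: normal; last by rewrite size_cat size_nseq sT.
    by rewrite /T /top_word !all_cat !short_nseq short_map.
  by rewrite (evalw_cat monoid_mul) pv_nseq // mul1 (pv_top_word _ _ (gen := genA)).
- apply: normal.
  + by case: (isL); rewrite /V /bot_word !all_cat short_wC !short_nseq short_map.
  + by move: xm; case: (isL) => xm; rewrite (evalw_cat monoid_mul) val_wC
      (pv_bot_word _ _ (gen := genA)) //.
  + by case: (isL); rewrite size_cat sV // addnC.
exists k, z; split=> //; last by rewrite initial_zipE.
have : size wC + n.+1 <= Q * n.+1.
  by rewrite size_map /Q /s; rewrite /s in sw; nia.
rewrite sT in kb; move: kb; rewrite -/n; set P := size wC + n.+1 => kb PQ.
have P1 : 1 <= P by rewrite /P; lia.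
have : k <= 20 * (P * P) by nia.
move/leq_trans; apply.
have := leq_mul PQ PQ; rewrite expnS expn1; nia.
Qed.

End Orders.

Theorem theorem6p2 (M : Type) (mul : M -> M -> M) (one : M)
  (hmon : is_monoid mul one)
  (hfg : exists (A : finType) (gen : A -> M), generates mul one gen)
  (hlc : left_cancellative mul)
  (hbi : bounded_indegree mul one)
  (hsh : strongly_hyperbolic mul one) :
  forall (A : finType) (gen : A -> M), generates mul one gen ->
    rel_in_NP mul one gen (L_le mul) /\ rel_in_NP mul one gen (R_le mul).
Proof.
move=> A gen _; case: (hmon) => mulA [mul1 mulx1].
have eqNP (P Q : M -> M -> Prop) : (forall x y, P x y <-> Q x y) ->
    rel_in_NP mul one gen P -> rel_in_NP mul one gen Q.
  move=> PQ [k [V VP]]; exists k, V => s; rewrite -VP.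
  by split=> -[u [v [e h]]]; exists u, v; split=> //; apply/PQ.
split.
(* Inclusion of principal ideals is tested on the generator [x] itself, a multiple of [x] by
   [one]. *)
- apply: eqNP (factor_in_NP hmon hlc hbi hsh gen true) => x y; split.
    by move=> [m ->] z [m' ->]; exists (mul m' m); rewrite mulA.
  by move=> h; apply: h; exists one; rewrite mul1.
- apply: eqNP (factor_in_NP hmon hlc hbi hsh gen false) => x y; split.
    by move=> [m ->] z [m' ->]; exists (mul m m'); rewrite mulA.
  by move=> h; apply: h; exists one; rewrite mulx1.
Qed.
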